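(* In the regression model $Y_i=f(i/n)+\varepsilon_i$, $1\le i\le n$, suppose that $f$ belongs to some Sobolev class $\mathcal{W}(\alpha,L)$ for $L>0$ and $\alpha>1/2$. Let $k_n\approx n^{1/(1+2\alpha)}$ and let $\widetilde W=\mathcal{N}(0,\gamma_nI_{k_n})$ be the prior on $\theta\in\mathbb{R}^{k_n}$, for a sequence $(\gamma_n)_{n\ge1}$ of positive numbers such that $1/\sqrt n=o(\gamma_n)$. Then $$E\left\|\widetilde W(d\theta\mid Y)-\mathcal{N}\left(\theta_Y,\tfrac{\sigma^2}{n}I_{k_n}\right)\right\|_{\mathrm{TV}}\longrightarrow0\qquad\text{as }n\to\infty,$$ and the convergence rate relative to the Euclidean norm for $f_\theta$ is $n^{-\alpha/(1+2\alpha)}$: for every sequence $\lambda_n\to\infty$, $$E\left[\widetilde W\left(\|f_\theta-f\|\ge\lambda_nn^{-\alpha/(1+2\alpha)}\mid Y\right)\right]\longrightarrow0 .$$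
   Context: Model: for each $n\ge1$ one observes $Y=(Y_1,\dots,Y_n)$ with $Y_i=f(i/n)+\varepsilon_i$, where the $\varepsilon_i$ are i.i.d. $\mathcal{N}(0,\sigma^2)$, $\sigma>0$ known and not depending on $n$, and $f:[0,1]\to\mathbb{R}$ is a fixed function; $E$ is expectation under this distribution. Fourier basis: $\varphi_1\equiv1$, $\varphi_{2m}(x)=\sqrt2\cos(2\pi mx)$, $\varphi_{2m+1}(x)=\sqrt2\sin(2\pi mx)$ for $m\ge1$. Sobolev class: for $\alpha,L>0$, $\mathcal{W}(\alpha,L)$ is the set of $f=\sum_{j\ge1}\theta_j\varphi_j\in L^2([0,1])$ with $\sum_{j\ge1}a_j^2\theta_j^2\le L^2/\pi^{2\alpha}$, where $a_j=j^\alpha$ if $j$ is even and $a_j=(j-1)^\alpha$ if $j$ is odd; for $\alpha>1/2$ the series converges uniformly and $f$ denotes its (continuous) sum. Regressors: $\phi_j=(\varphi_j(i/n))_{1\le i\le n}\in\mathbb{R}^n$, $1\le j\le k_n$, and $\Phi$ is the $n\times k_n$ matrix with columns $\phi_j$ (for $n$ large it has rank $k_n$). $\theta_Y=(\Phi^T\Phi)^{-1}\Phi^TY$. For $\theta\in\mathbb{R}^{k_n}$, $f_\theta=\sum_{j=1}^{k_n}\theta_j\varphi_j$. $\widetilde W(\cdot\mid Y)$ is the posterior distribution of $\theta$ when $\theta\sim\widetilde W$ and, conditionally on $\theta$, $Y\sim\mathcal{N}(\Phi\theta,\sigma^2I_n)$. $\|f_\theta-f\|$ is the $L^2([0,1])$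 norm, equal to the $\ell^2$ norm of the difference of the Fourier coefficient sequences. $a_n\approx b_n$ means that $a_n/b_n$ is bounded above and below by positive constants. $\|Q-Q'\|_{\mathrm{TV}}=\sup_A|Q(A)-Q'(A)|$. *)

(* Defs.v *)
(* MathComp-Analysis; points of R^k are column vectors for linear algebra and
   k-tuples for measure theory (the product sigma-algebra of k.-tuple R). *)
From HB Require Import structures.
From mathcomp Require Import all_boot all_order all_algebra.
From mathcomp Require Import all_classical all_reals all_analysis.

Set Implicit Arguments.
Unset Strict Implicit.
Unset Printing Implicit Defensive.

Import Order.TTheory GRing.Theory Num.Theory.
Import numFieldNormedType.Exports.

Local Open Scope classical_set_scope.
Local Open Scope ring_scope.

Notation Rn R n := (n.-tuple (measurableTypeR R)).

Definition col_of (R : realType) n (y : Rn R n) : 'cV[R]_n := \col_i tnth y i.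

Section product_measure.
Context (R : realType) (n : nat).

Definition cons_pair (x : measurableTypeR R * Rn R n) : Rn R n.+1 :=
  [tuple of x.1 :: x.2].

Lemma measurable_cons_pair : measurable_fun setT cons_pair.
Proof. exact: measurable_cons measurable_fst measurable_snd. Qed.

HB.instance Definition _ :=
  isMeasurableFun.Build _ _ _ _ cons_pair measurable_cons_pair.

End product_measure.

(* The product measure mu_0 (x) ... (x) mu_(n-1) on R^n. *)
Fixpoint prod_probability (R : realType) n :
    ('I_n -> probability (measurableTypeR R) R) -> probability (Rn R n) R :=
  match n with
  | 0 => fun _ => \d_([tuple] : Rn R 0)
  | m.+1 => fun mu =>
      distribution
        ((mu ord0 \x prod_probability (fun i => mu (lift ord0 i)))%E
          : probability (measurableTypeR R * Rn R m)%type R)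
        (@cons_pair R m)
  end.

Lemma prod_probabilityE (R : realType) n
    (mu : 'I_n -> probability (measurableTypeR R) R)
    (B : 'I_n -> set (measurableTypeR R)) :
  (forall i, measurable (B i)) ->
  prod_probability mu [set t | forall i, B i (tnth t i)] =
  (\prod_(i < n) mu i (B i))%E.
Proof.
elim: n mu B => [|n IH] mu B mB.
  by rewrite big_ord0 /= /dirac indicE mem_set//=; case.
rewrite big_ord_recl /= /distribution /pushforward.
rewrite -IH; last by move=> i; exact: mB.
rewrite -product_measure1E//; last first.
  rewrite [X in measurable X](_ : _ = \bigcap_(i in [set: 'I_n])
      ((fun t : Rn R n => tnth t i) @^-1` B (lift ord0 i))); last first.
    by apply/seteqP; split=> t /= h i; [move=> _; exact: h|exact: h].
  apply: fin_bigcap_measurable => // i _.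
  by rewrite -[X in measurable X]setTI; apply: measurable_tnth.
congr (_ _); apply/seteqP; split=> -[x t] /=.
- move=> h; split; first by have := h ord0.
  by move=> i; have := h (lift ord0 i); rewrite tnthS.
- by move=> [h1 h2] i; case: (unliftP ord0 i) => [j|] ->//; rewrite ?tnthS//.
Qed.

(* N(m, v I_n): independent coordinates N(m_i, v); the second parameter of
   normal_prob is the standard deviation. *)
Definition mvnormal (R : realType) n (m : 'cV[R]_n) (v : R) :
    probability (Rn R n) R :=
  prod_probability (fun i => normal_prob (m i 0) (Num.sqrt v)).

Definition tv_dist d (T : measurableType d) (R : realType)
    (Q Q' : set T -> \bar R) : \bar R :=
  ereal_sup [set `|Q A - Q' A|%E | A in measurable].

Definition mutually_independent (R : realType) d (Omega : measurableType d)
    (P : probability Omega R) n (X : 'I_n -> {RV P >-> measurableTypeR R}) :=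
  forall (J : {set 'I_n}) (B : 'I_n -> set (measurableTypeR R)),
    (forall i, measurable (B i)) ->
    P (\bigcap_(i in [set` J]) (X i @^-1` B i)) =
    (\prod_(i in J) P (X i @^-1` B i))%E.

Definition iid_normal (R : realType) d (Omega : measurableType d)
    (P : probability Omega R) n (X : 'I_n -> {RV P >-> measurableTypeR R})
    (sigma : R) :=
  mutually_independent X /\
  forall i (B : set (measurableTypeR R)), measurable B ->
    distribution P (X i) B = normal_prob 0 sigma B.

(* post is (a version of) the conditional law of theta given Y in the Bayesian
   model theta ~ prior, Y | theta ~ model theta: for all A and B,
   P(theta in A, Y in B) = E[1_B(Y) post(Y)(A)]. *)
Definition is_posterior (R : realType) d d' (Theta : measurableType d)
    (X : measurableType d') (prior : probability Theta R)
    (model : Theta -> probability X R) (post : R.-pker X ~> Theta) :=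
  forall (A : set Theta) (B : set X), measurable A -> measurable B ->
    (\int[prior]_(t in A) model t B =
     \int[prior]_t \int[model t]_(y in B) post y A)%E.

Section fourier.
Variable R : realType.
Implicit Types (j : nat) (x : R).

(* Indexed by j >= 1; the value at j = 0 is never used. *)
Definition fourier j x : R :=
  if j == 1 then 1
  else if odd j then Num.sqrt 2 * sin (2 * pi * j./2%:R * x)
  else Num.sqrt 2 * cos (2 * pi * j./2%:R * x).

Definition sobolev_weight (alpha : R) j : R :=
  if odd j then j.-1%:R `^ alpha else j%:R `^ alpha.

(* For alpha > 1/2, the only case used, the ellipsoid condition makes the
   Fourier series normally convergent; a member is the continuous sum itself,
   rather than its class modulo null sets. Values off [0, 1] are unconstrained. *)
Definition sobolev (alpha L : R) : set (R -> R) :=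
  [set f | exists theta : nat -> R,
    (\sum_(1 <= j <oo) ((sobolev_weight alpha j) ^+ 2 * theta j ^+ 2)%:E
       <= (L ^+ 2 / pi `^ (2 * alpha))%:E)%E /\
    forall x, x \in `[0, 1] ->
      (fun N => \sum_(1 <= j < N.+1) theta j * fourier j x) @ \oo --> f x].

Definition L2norm01 (g : R -> R) : \bar R :=
  ('N[@lebesgue_measure R]_2%:E [EFin \o (g \_ `[0%R, 1%R])])%E.

End fourier.

Section regression.
Variable R : realType.

(* The i-th design point, i = 0 .. n-1, is (i + 1) / n. *)
Definition design n (i : 'I_n) : R := i.+1%:R / n%:R.

Definition design_matrix n k : 'M[R]_(n, k) :=
  \matrix_(i, j) fourier j.+1 (design i).

Definition f_of k (theta : Rn R k) (x : R) : R :=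
  \sum_(j < k) tnth theta j * fourier j.+1 x.

Definition least_squares n k (y : Rn R n) : 'cV[R]_k :=
  let Phi := design_matrix n k in
  invmx (Phi^T *m Phi) *m Phi^T *m col_of y.

Definition observation (f : R -> R) d (Omega : measurableType d)
    (P : probability Omega R) n (eps : 'I_n -> {RV P >-> measurableTypeR R})
    (w : Omega) : Rn R n :=
  [tuple f (design i) + eps i w | i < n].

End regression.

(* Main.v *)
(* Since k_n = o(sqrt n), the discrete Fourier vectors are orthogonal and the
   posterior is exactly N(s theta_Y, s sigma^2/n I), where the shrinkage
   s = gamma n / (sigma^2 + gamma n) satisfies 1 - s = o(1 / sqrt n). A posterior
   kernel is determined only up to a null set of observations, but the marginal
   law of Y in the Bayesian model and its law under f are equivalent.

   Total variation: if Q has density exp(-U) with respect to P then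
   |Q - P| <= E_P |U|. For the two normal laws at hand U is a quadratic polynomial
   whose expectation is of order k (1 - s) + D (1 + |theta_Y|^2), with
   D = (1 - s) sqrt n / sigma -> 0.

   Rate: by Markov's inequality it remains to bound the mean squared errors. The
   bias of theta_Y comes from the aliases of the frequencies below k, that is from
   coefficients of index at least n; a Schur test with the Sobolev weights bounds
   its square by a multiple of n^(-2 alpha). *)
Require Import Defs.
From HB Require Import structures.
From mathcomp Require Import all_boot all_order all_algebra.
From mathcomp Require Import all_classical all_reals all_analysis.
From mathcomp Require Import measurable_realfun ring lra zify.
Set Implicit Arguments.
Unset Strict Implicit.
Unset Printing Implicit Defensive.
Import Order.TTheory GRing.Theory Num.Theory.
Import numFieldNormedType.Exports.
Local Open Scope classical_set_scope.
Local Open Scope ring_scope.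

(** * Densities of product measures *)

(** The condition on gamma_n enters through the location: the centre s theta_Y lies (1 - s) theta_Y
    away from theta_Y, which in units of the standard deviation sigma / sqrt n is D |theta_Y|, and D
    <= sigma / (sqrt n gamma_n). The change of scale costs 1 - s in each of the k directions; since
    alpha > 1/2 gives k = O(sqrt n), this cost is O(1 / (sqrt n gamma_n)) as well. What remains is a
    bounded second moment of theta_Y under f, a by-product of the risk bound for least squares. The
    second claim reuses the first: the posterior is exchanged for its normal approximation at the
    price of their total variation distance, and Markov's inequality is applied to the
    approximation. Each n has its own probability space, so all estimates are explicit inequalities
    at a fixed n, and limits are taken only at the end. *)

Section integral_aux.
Local Open Scope ereal_scope.
Context d (T : measurableType d) (R : realType).

Import HBNNSimple.

(* Measurability is not required: the integral of a nonnegative function is a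
   supremum over the simple functions below it. *)
Lemma ge0_le_integralT (mu : {measure set T -> \bar R}) (f g : T -> \bar R) :
  (forall x, 0 <= f x) -> (forall x, f x <= g x) ->
  \int[mu]_x f x <= \int[mu]_x g x.
Proof.
move=> f0 fg; have g0 x : 0 <= g x by exact: le_trans (fg x).
rewrite !ge0_integralTE//; apply: le_ereal_sup => _ [h hf <-].
exists h => // x; exact: le_trans (fg x).
Qed.

(** The hypothesis is the conclusion for indicators; finite sums extend it to simple functions, and
    monotone convergence along [nnsfun_approx] to [g]. *)
Lemma ge0_integral_density (mu nu : {measure set T -> \bar R}) (r : T -> R)
    (mr : measurable_fun setT r) (r0 : forall x, (0 <= r x)%R) :
  (forall A, measurable A -> nu A = \int[mu]_(x in A) (r x)%:E) ->
  forall g : T -> \bar R, measurable_fun setT g -> (forall x, 0 <= g x) ->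
  \int[nu]_x g x = \int[mu]_x (g x * (r x)%:E).
Proof.
move=> nuE g mg g0.
have mr' : measurable_fun setT (EFin \o r) by exact/measurable_EFinP.
pose g_ := nnsfun_approx measurableT mg.
have cg x : (g_ n x)%:E @[n --> \oo] --> g x.
  by apply: cvg_nnsfun_approx => // y _; exact: g0.
have ndg : forall x, nondecreasing_seq (fun n => (g_ n x)%:E).
  by move=> x m n mn; rewrite lee_fin; exact/lefP/nd_nnsfun_approx.
transitivity (limn (fun n => \int[nu]_x (g_ n x)%:E)).
  rewrite -monotone_convergence//.
  - by apply: eq_integral => y _; apply/esym/cvg_lim => //; exact: cg.
  - by move=> n; exact/measurable_EFinP.
  - by move=> n y _; rewrite lee_fin.
transitivity (limn (fun n => \int[mu]_x ((g_ n x)%:E * (r x)%:E))); last first.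
  rewrite -monotone_convergence//.
  - apply: eq_integral => y _; apply/cvg_lim => //.
    apply: cvgeZr => //; exact: cg.
  - by move=> n; apply: emeasurable_funM => //; exact/measurable_EFinP.
  - by move=> n y _; rewrite mule_ge0// lee_fin.
  - by move=> y _ m n mn; rewrite lee_wpmul2r ?lee_fin//; move: (ndg y m n mn).
apply: congr_lim; apply/funext => n.
rewrite integralT_nnsfun sintegralE.
transitivity (\int[mu]_x (\sum_(y \in range (g_ n))
    (y%:E * ((r x)%:E * (\1_(g_ n @^-1` [set y]) x)%:E)))).
  rewrite ge0_integral_fsum//.
  - apply: eq_fsbigr => y; rewrite inE => -[x _ <-].
    rewrite ge0_integralZl//.
    + congr (_ * _); rewrite nuE//.
      by rewrite integral_mkcond epatch_indic.
    + by apply: emeasurable_funM => //; exact/measurable_EFinP.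
    + by move=> z _; rewrite mule_ge0// lee_fin.
    + by rewrite lee_fin.
  - move=> y; apply: measurable_funeM; apply: emeasurable_funM => //.
    exact/measurable_EFinP.
  (* The term must be nonnegative for every real [y], even a negative one; a [y] outside the range
     of [g_ n] has an empty preimage, so the indicator makes the term 0. *)
  - move=> y x _; have [[z _ <-]|yr] := pselect (range (g_ n) y).
      by rewrite !mule_ge0// lee_fin.
    rewrite indicE memNset ?mule0//= => gxy; apply: yr; exists x => //.
apply: eq_integral => x _.
rewrite [in RHS](fimfunE (g_ n) x) -fsumEFin// ge0_mule_fsuml//.
  by apply: eq_fsbigr => y _; rewrite EFinM -muleA [X in _ * X]muleC.
move=> y; rewrite lee_fin; have [[z _ <-]|yr] := pselect (range (g_ n) y).
  by rewrite mulr_ge0.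
rewrite indicE memNset ?mulr0//= => gxy; apply: yr; exists x => //.
Qed.

End integral_aux.

Section prod_probability.
Local Open Scope ereal_scope.
Context (R : realType).
Let PR := probability (measurableTypeR R) R.

Lemma ge0_integral_prod_probabilityS n (mu : 'I_n.+1 -> PR)
    (g : Rn R n.+1 -> \bar R) :
  measurable_fun setT g -> (forall t, 0 <= g t) ->
  \int[prod_probability mu]_t g t = \int[mu ord0]_x
    \int[prod_probability (fun i => mu (lift ord0 i))]_t g (cons_pair (x, t)).
Proof.
move=> mg g0; rewrite /= ge0_integral_distribution//.
rewrite fubini_tonelli1//.
- by apply: measurableT_comp => //; exact: measurable_cons_pair.
- by move=> x; exact: g0.
Qed.

Lemma measurable_prod_tnth n (r : 'I_n -> measurableTypeR R -> R) :
  (forall i, measurable_fun setT (r i)) ->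
  measurable_fun setT (fun t : Rn R n => \prod_i r i (tnth t i))%R.
Proof.
move=> mr; apply: measurable_prod => i _.
apply: (measurableT_comp (mr i)); exact: measurable_tnth.
Qed.

(** Tonelli peels off the first coordinate: the outer integral changes density in dimension one, the
    inner one by induction. Working with functions lets the induction hypothesis apply to the
    section of [g] at a fixed first coordinate. *)
Lemma ge0_integral_prod_density n (mu nu : 'I_n -> PR) (r : 'I_n -> measurableTypeR R
  -> R) :
  (forall i, measurable_fun setT (r i)) -> (forall i x, (0 <= r i x)%R) ->
  (forall i A, measurable A -> nu i A = \int[mu i]_(x in A) (r i x)%:E) ->
  forall g : Rn R n -> \bar R, measurable_fun setT g -> (forall t, 0 <= g t) ->
  \int[prod_probability nu]_t g t =
  \int[prod_probability mu]_t (g t * (\prod_i r i (tnth t i))%:E).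
Proof.
elim: n mu nu r => [|n IH] mu nu r mr r0 nuE g mg g0.
  by apply: eq_integral => t _; rewrite big_ord0 mule1.
have mcons : measurable_fun setT (@cons_pair R n) by exact: measurable_cons_pair.
have mpair x : measurable_fun setT (fun t => cons_pair (x, t) : Rn R n.+1).
  by apply: (measurableT_comp mcons); exact: measurable_pair1.
rewrite ge0_integral_prod_probabilityS// ge0_integral_prod_probabilityS//; last 2 first.
- apply: emeasurable_funM => //; apply/measurable_EFinP.
  exact: measurable_prod_tnth.
- by move=> t; rewrite mule_ge0// lee_fin prodr_ge0.
rewrite (ge0_integral_density (mr ord0) (r0 ord0) (nuE ord0)); last 2 first.
- apply: (measurable_fun_fubini_tonelli_F
    (m2 := prod_probability (fun i => nu (lift ord0 i))) (g \o @cons_pair R n)).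
  + exact: measurableT_comp mg mcons.
  + by move=> x; exact: g0.
- by move=> x; exact: integral_ge0.
apply: eq_integral => x _.
have mgx : measurable_fun setT (fun t => g (cons_pair (x, t))).
  exact: measurableT_comp mg (mpair x).
rewrite (IH (fun i => mu (lift ord0 i)) _ (fun i => r (lift ord0 i))
  (fun i => mr _) (fun i => r0 _) (fun i => nuE _))//.
rewrite muleC -ge0_integralZl//.
- apply: eq_integral => t _; rewrite muleCA; congr (_ * _).
  rewrite -EFinM big_ord_recl/=; congr (_ * _)%:E.
  by apply: eq_bigr => i _; rewrite tnthS.
- apply: emeasurable_funM => //.
  apply/measurable_EFinP; apply: (@measurable_prod_tnth n (fun i => r (lift ord0 i)))
    => i; exact: mr.
- by move=> t _; rewrite mule_ge0// lee_fin prodr_ge0.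
- by rewrite lee_fin.
Qed.

End prod_probability.

Section tv.
Local Open Scope ereal_scope.
Context d (T : measurableType d) (R : realType).

Lemma tv_dist_le_density (P Q : probability T R) (U : T -> R) :
  measurable_fun setT U ->
  (forall A, measurable A -> Q A = \int[P]_(x in A) (expR (- U x))%:E) ->
  tv_dist Q P <= \int[P]_x `|U x|%:E.
Proof.
move=> mU QE; set I := (X in _ <= X).
have mabsU : measurable_fun setT (fun x => (`|U x|%R)%:E).
  by apply/measurable_EFinP; exact: measurableT_comp.
have mexpU : measurable_fun setT (fun x => (expR (- U x))%:E).
  by apply/measurable_EFinP; apply: measurableT_comp => //; exact: measurableT_comp.
(* 1 <= exp (- U) + |U|, integrated over A and over its complement *)
have PQ A : measurable A -> P A <= Q A + I.
  move=> mA; rewrite -[P A]mul1e -(integral_cst P mA 1) QE//.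
  apply: (@le_trans _ _ (\int[P]_(x in A) ((expR (- U x))%:E + `|U x|%:E))).
    apply: ge0_le_integral => //.
    - apply: measurable_funTS; exact: emeasurable_funD.
    - move=> x _; rewrite -EFinD lee_fin.
      have := expR_ge1Dx (- U x); have := ler_norm (U x); lra.
  rewrite ge0_integralD//; [|exact: measurable_funTS..].
  rewrite leeD2l//; apply: ge0_subset_integral => //.
apply: ge_ereal_sup => _ [A mA <-].
have mcA : measurable (~` A) by exact: measurableC.
have PQ1 := PQ _ mA; have PQ2 := PQ _ mcA.
move: PQ1 PQ2; rewrite !probability_setC//.
have [P1 Q1] : P A \is a fin_num /\ Q A \is a fin_num.
  by split; exact: fin_num_measure.
have : 0 <= I by apply: integral_ge0.
move: (I) => [r| |]; rewrite ?leey//.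
rewrite -(fineK P1) -(fineK Q1) -!EFinB !lee_fin => r0 h1 h2.
by rewrite ler_norml; lra.
Qed.
End tv.

(** * Normal laws *)

Section normal.
Context (R : realType).
Implicit Types (m v : R).

(** Density of N(m', v') relative to N(m, v); [v] and [v'] are variances. *)
Definition normal_ratio m v m' v' (x : measurableTypeR R) : R :=
  Num.sqrt (v / v') * expR ((x - m) ^+ 2 / (2 * v) - (x - m') ^+ 2 / (2 * v')).

Lemma measurable_normal_ratio m v m' v' :
  measurable_fun setT (normal_ratio m v m' v').
Proof.
apply: measurable_funM => //; apply: measurableT_comp => //.
by apply: measurable_funB; apply: measurable_funM => //;
  apply: measurable_funX; apply: measurable_funB.
Qed.

Lemma normal_ratio_ge0 m v m' v' x : 0 <= normal_ratio m v m' v' x.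
Proof. by rewrite mulr_ge0 ?sqrtr_ge0 ?expR_ge0. Qed.

Lemma normal_pdf_ratio m v m' v' x : 0 < v -> 0 < v' ->
  normal_pdf m' (Num.sqrt v') x =
  normal_ratio m v m' v' x * normal_pdf m (Num.sqrt v) x.
Proof.
move=> v0 v'0; rewrite !normal_pdfE ?gt_eqF ?sqrtr_gt0//.
rewrite /normal_ratio /normal_peak /normal_fun !sqr_sqrtr ?ltW//.
rewrite mulrACA -expRD; congr (_ * expR _).
  rewrite -!sqrtrV; last 2 first.
    by rewrite mulrn_wge0// mulr_ge0 ?pi_ge0 ?ltW.
    by rewrite mulrn_wge0// mulr_ge0 ?pi_ge0 ?ltW.
  rewrite -sqrtrM ?divr_ge0 ?ltW//; congr Num.sqrt.
  have := pi_gt0 R; move: (pi : R) => p p0; field.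
  by rewrite !gt_eqF.
field.
by rewrite !gt_eqF.
Qed.

Lemma normal_prob_density m v m' v' : 0 < v -> 0 < v' ->
  forall A : set (measurableTypeR R), measurable A ->
  (normal_prob m' (Num.sqrt v') A =
   \int[normal_prob m (Num.sqrt v)]_(x in A) (normal_ratio m v m' v' x)%:E)%E.
Proof.
move=> v0 v'0 A mA.
have mr := measurable_normal_ratio m v m' v'.
rewrite [RHS]integral_mkcond.
rewrite (@ge0_integral_density _ _ _ lebesgue_measure
  (normal_prob m (Num.sqrt v)) (normal_pdf m (Num.sqrt v)))//.
- rewrite /normal_prob [LHS]integral_mkcond. apply: eq_integral => x _.
  rewrite !patchE; case: ifPn => _; last by rewrite mul0e.
  by rewrite (normal_pdf_ratio m m' x v0 v'0) EFinM.
- exact: measurable_normal_pdf.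
- exact: normal_pdf_ge0.
- apply: (measurable_restrictT _ mA).1; apply: measurable_funTS.
  exact/measurable_EFinP.
- by move=> x; rewrite patchE; case: ifPn => // _; rewrite lee_fin normal_ratio_ge0.
Qed.

Definition mvnormal_ratio n (m : 'cV[R]_n) v (m' : 'cV[R]_n) v' (t : Rn R n) : R :=
  \prod_i normal_ratio (m i 0) v (m' i 0) v' (tnth t i).

Lemma mvnormal_ratio_ge0 n (m : 'cV[R]_n) v (m' : 'cV[R]_n) v' t :
  0 <= mvnormal_ratio m v m' v' t.
Proof. by apply: prodr_ge0 => i _; exact: normal_ratio_ge0. Qed.

Lemma measurable_mvnormal_ratio n (m : 'cV[R]_n) v (m' : 'cV[R]_n) v' :
  measurable_fun setT (mvnormal_ratio m v m' v').
Proof.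
apply: (@measurable_prod_tnth _ _ (fun i => normal_ratio (m i 0) v (m' i 0) v')).
by move=> i; exact: measurable_normal_ratio.
Qed.

Lemma ge0_integral_mvnormal n (m : 'cV[R]_n) v (m' : 'cV[R]_n) v' :
  0 < v -> 0 < v' ->
  forall g : Rn R n -> \bar R, measurable_fun setT g -> (forall t, 0 <= g t)%E ->
  (\int[mvnormal m' v']_t g t =
   \int[mvnormal m v]_t (g t * (mvnormal_ratio m v m' v' t)%:E))%E.
Proof.
move=> v0 v'0 g mg g0.
apply: (@ge0_integral_prod_density _ _ _ _
  (fun i => normal_ratio (m i 0) v (m' i 0) v')) => //.
- by move=> i; exact: measurable_normal_ratio.
- by move=> i x; exact: normal_ratio_ge0.
- by move=> i A mA; exact: normal_prob_density.
Qed.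

Lemma mvnormal_density n (m : 'cV[R]_n) v (m' : 'cV[R]_n) v' :
  0 < v -> 0 < v' -> forall A, measurable A ->
  (mvnormal m' v' A =
   \int[mvnormal m v]_(t in A) (mvnormal_ratio m v m' v' t)%:E)%E.
Proof.
move=> v0 v'0 A mA; have mI : measurable_fun setT (fun t => (\1_A t)%:E : \bar R).
  by apply/measurable_EFinP; exact: measurable_indic.
transitivity (\int[mvnormal m' v']_t (\1_A t)%:E)%E.
  by rewrite integral_indic// setIT.
have I0 t : (0 <= (\1_A t)%:E :> \bar R)%E by rewrite lee_fin.
apply: (etrans (ge0_integral_mvnormal m m' v0 v'0 mI I0)).
rewrite [RHS]integral_mkcond; apply: eq_integral => t _.
by rewrite patchE indicE; case: ifPn => _; rewrite ?mul1e ?mul0e.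
Qed.

(** For x >= 0, x^2 <= 4 (1 + x/2)^2 and 1 + x/2 <= exp(x/2); the other sign is symmetric. This
    trades a square for exponentials, whose Gaussian means are explicit. *)
Lemma sqr_le_expR (x : R) : x ^+ 2 <= 4 * (expR x + expR (- x)).
Proof.
wlog x0 : x / 0 <= x.
  move=> h; have [/h//|/ltW xn] := leP 0 x.
  by have := h (- x); rewrite oppr_ge0 sqrrN opprK addrC; apply.
have : (1 + x / 2) ^+ 2 <= expR x.
  rewrite [x in leRHS]splitr expRD -expr2 lerXn2r ?nnegrE ?expR_ge0//.
    lra.
  exact: expR_ge1Dx.
have := expR_ge0 (- x); nra.
Qed.

End normal.

Section moments.
Context (R : realType).
Implicit Types (v : R).

(** Exponential tilting: a shift of the mean by [v * a] multiplies the density by the exponential of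
    an affine function of [x]. *)
Lemma normal_ratio_shift (m v a x : R) : 0 < v ->
  normal_ratio m v (m + v * a) v x = expR (a * (x - m) - v * a ^+ 2 / 2).
Proof.
move=> v0; rewrite /normal_ratio divff ?gt_eqF// sqrtr1 mul1r; congr expR.
by field; rewrite gt_eqF.
Qed.

Lemma measurable_linear_form n (c : 'I_n -> R) (m : 'cV[R]_n) :
  measurable_fun setT (fun t : Rn R n => \sum_i c i * (tnth t i - m i 0)).
Proof.
apply: measurable_sum => i; apply: measurable_funM => //.
by apply: measurable_funB => //; exact: measurable_tnth.
Qed.

Lemma mvnormal_mgf n (m : 'cV[R]_n) v (a : 'I_n -> R) : 0 < v ->
  (\int[mvnormal m v]_t (expR (\sum_i a i * (tnth t i - m i 0)))%:E =
   (expR (v * (\sum_i a i ^+ 2) / 2))%:E)%E.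
Proof.
move=> v0; pose m' := \col_i (m i 0 + v * a i).
have := @mvnormal_density R n m v m' v v0 v0 setT measurableT.
rewrite probability_setT => h.
rewrite -[RHS]mule1 h -ge0_integralZl//; first last.
- by move=> t _; rewrite lee_fin mvnormal_ratio_ge0.
- by apply/measurable_EFinP; exact: measurable_mvnormal_ratio.
apply: eq_integral => t _; rewrite -EFinM; congr EFin.
rewrite /mvnormal_ratio.
under eq_bigr do rewrite mxE normal_ratio_shift//.
rewrite -expR_sum -expRD; congr expR.
rewrite sumrB -mulr_suml -mulr_sumr; ring.
Qed.

(** The factor 8 is the 4 of [sqr_le_expR] times its two exponentials; after normalisation each has
    mean exp(1/2), rounded up to e. *)
Definition gaussK : R := 8 * expR 1.

Lemma gaussK_ge0 : 0 <= gaussK.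
Proof. by rewrite mulr_ge0 ?expR_ge0. Qed.

(* Up to the constant, the second moment is controlled by the moment generating
   function, hence by the total mass of a shifted normal density; neither the mean
   nor the variance of the normal law is needed. *)
Lemma mvnormal_sqr_le n (m : 'cV[R]_n) v (c : 'I_n -> R) : 0 < v ->
  (\int[mvnormal m v]_t ((\sum_i c i * (tnth t i - m i 0)) ^+ 2)%:E <=
   (gaussK * v * \sum_i c i ^+ 2)%:E)%E.
Proof.
move=> v0; have [S0|S0] := eqVneq (\sum_i c i ^+ 2) 0.
  have c0 i : c i = 0.
    apply/eqP; rewrite -sqrf_eq0; apply/eqP.
    by apply: (psumr_eq0P _ S0) => // j _; exact: sqr_ge0.
  rewrite S0 mulr0 integral0_eq// => t _.
  by rewrite big1 ?expr0n// => i _; rewrite c0 mul0r.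
have [S SE] : exists S, S = v * \sum_i c i ^+ 2 by eexists.
have Sgt0 : 0 < S by rewrite SE mulr_gt0// lt_neqAle eq_sym S0 sumr_ge0// => i _;
  exact: sqr_ge0.
(* Dividing by [Num.sqrt S] normalises the variance to 1, so both generating functions equal
   exp(1/2); the signs [s = 1] and [s = -1] give the two exponentials of [sqr_le_expR]. *)
pose a (s : R) i := s * (c i / Num.sqrt S).
have asq s : s ^+ 2 = 1 -> v * (\sum_i a s i ^+ 2) = 1.
  move=> s1; under eq_bigr do rewrite /a exprMn s1 mul1r expr_div_n sqr_sqrtr ?ltW//.
  by rewrite -mulr_suml mulrA -SE divff ?gt_eqF.
have aE s (t : Rn R n) : \sum_i a s i * (tnth t i - m i 0) =
    s * ((\sum_i c i * (tnth t i - m i 0)) / Num.sqrt S).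
  by rewrite mulr_suml mulr_sumr; apply: eq_bigr => i _; rewrite /a; ring.
have mexp s : measurable_fun setT
    (fun t : Rn R n => (expR (\sum_i a s i * (tnth t i - m i 0)))%:E).
  by apply/measurable_EFinP; apply: measurableT_comp => //; exact: measurable_linear_form.
apply: (@le_trans _ _ (\int[mvnormal m v]_t ((4 * S)%:E *
    ((expR (\sum_i a 1 i * (tnth t i - m i 0)))%:E +
     (expR (\sum_i a (-1) i * (tnth t i - m i 0)))%:E)))%E).
  apply: ge0_le_integralT => t; first by rewrite lee_fin sqr_ge0.
  rewrite -EFinD -EFinM lee_fin !aE mul1r mulN1r.
  set W := \sum_i _.
  have -> : W ^+ 2 = S * (W / Num.sqrt S) ^+ 2.
    by rewrite expr_div_n sqr_sqrtr ?ltW// mulrC divfK// gt_eqF.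
  by rewrite [4 * S]mulrC -mulrA ler_pM2l// sqr_le_expR.
have e0 s (t : Rn R n) : (0 <= (expR (\sum_i a s i * (tnth t i - m i 0)))%:E)%E.
  by rewrite lee_fin expR_ge0.
rewrite ge0_integralZl//; first last.
- by rewrite lee_fin; nra.
- by move=> t _; rewrite adde_ge0.
- exact: emeasurable_funD.
rewrite ge0_integralD// !mvnormal_mgf// !asq ?sqrrN ?expr1n//.
rewrite -EFinD -EFinM lee_fin /gaussK -[leRHS]mulrA -SE.
have : expR (1 / 2) <= expR 1 :> R by rewrite ler_expR; lra.
nra.
Qed.

Lemma mvnormal_sum_sqr_le n (m : 'cV[R]_n) v : 0 < v ->
  (\int[mvnormal m v]_t (\sum_i (tnth t i - m i 0) ^+ 2)%:E <=
   (gaussK * v * n%:R)%:E)%E.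
Proof.
move=> v0; under eq_integral do rewrite -sumEFin.
rewrite ge0_integral_sum//; last 2 first.
- move=> i; apply/measurable_EFinP; apply: measurable_funX.
  by apply: measurable_funB => //; exact: measurable_tnth.
- by move=> i t _; rewrite lee_fin sqr_ge0.
rewrite mulr_natr -[n in leRHS]card_ord -sumr_const -sumEFin.
apply: lee_sum => i _.
have := @mvnormal_sqr_le n m v (fun j => (j == i)%:R) v0.
have -> : \sum_j ((j == i)%:R : R) ^+ 2 = 1.
  rewrite (bigD1 i)//= eqxx expr1n big1 ?addr0// => j /negbTE ->.
  by rewrite expr0n.
rewrite mulr1; apply: le_trans; rewrite le_eqVlt; apply/orP; left; apply/eqP.
apply: eq_integral => t _; congr (_ ^+ 2)%:E.
rewrite (bigD1 i)//= eqxx mul1r big1 ?addr0// => j /negbTE ->.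
by rewrite mul0r.
Qed.

End moments.

(** * Rational orthants as a determining class on R^k *)

Section orthants.
Context (R : realType) (k : nat).

(** Rational endpoints keep the family countable, so that one null set can serve all its members. *)
Definition orthant (q : k.-tuple rat) : set (Rn R k) :=
  [set t | forall i, `](ratr (tnth q i) : R), +oo[%classic (tnth t i)].

Lemma measurable_orthant q : measurable (orthant q).
Proof.
rewrite (_ : orthant q = \bigcap_(i in [set: 'I_k])
    ((fun t : Rn R k => tnth t i) @^-1` `](ratr (tnth q i) : R), +oo[%classic)).
  apply: fin_bigcap_measurable => // i _.
  rewrite -[X in measurable X]setTI; apply: measurable_tnth => //.
by apply/seteqP; split => t /= h i; [move=> _|]; exact: h.
Qed.

(** The whole space is added as the covering sequence that uniqueness of measures asks for. *)
Let G : set (set (Rn R k)) := [set A | A = setT \/ exists q, A = orthant q].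

Let orthantsI : setI_closed G.
Proof.
move=> A B [->|[p ->]] [->|[q ->]].
- by left; rewrite setIT.
- by right; exists q; rewrite setTI.
- by right; exists p; rewrite setIT.
right; exists [tuple Num.max (tnth p i) (tnth q i) | i < k].
apply/seteqP; split => [t [hp hq] i|t h].
  have := hp i; have := hq i; rewrite /= !in_itv/= !andbT tnth_mktuple.
  by rewrite /Num.max; case: ifP.
split => i; have := h i; rewrite /= !in_itv/= !andbT tnth_mktuple.
  apply: le_lt_trans; rewrite ler_rat.
  by rewrite le_max lexx.
by apply: le_lt_trans; rewrite ler_rat le_max lexx orbT.
Qed.

Let measurable_orthantsE : @measurable _ (Rn R k) = <<s G >>.
Proof.
apply/seteqP; split; last first.
  apply: smallest_sub; first exact: sigma_algebra_measurable.
  by move=> A [->|[q ->]]; [exact: measurableT|exact: measurable_orthant].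
apply: smallest_sub; first exact: smallest_sigma_algebra.
rewrite -bigcup_seq => A [i _ [B mB <-]].
have : measurable_fun (setT : set (g_sigma_algebraType G))
    ((fun t => tnth t i) : g_sigma_algebraType G -> measurableTypeR R).
  apply: (measurability _ (RGenOInfty.measurableE R)) => _ [_ [x ->] <-].
  (* The half-space where coordinate [i] exceeds [x] is the union of the orthants whose [i]-th
     endpoint is at least [x]; the other endpoints can be any rationals below the coordinates of the
     point. *)
  rewrite setTI (_ : _ @^-1` _ = \bigcup_(q : k.-tuple rat)
      (if x <= ratr (tnth q i) then orthant q else set0)).
    apply: (@countable_bigcupT_measurable _ (g_sigma_algebraType G)).
      exact: countableP.
    move=> q; case: ifP => _; last exact: measurable0.
    by apply: sub_sigma_algebra; right; exists q.
  apply/seteqP; split => t /=.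
    rewrite in_itv/= andbT => xt.
    have hq j : exists q : rat, ratr q < tnth t j /\ (j = i -> x <= ratr q).
      have [->|ji] := eqVneq j i.
        have [q] := rat_in_itvoo xt; rewrite in_itv/= => /andP[xq qt].
        by exists q; split => // _; exact: ltW.
      have [q] : exists q : rat, ratr q \in `](tnth t j - 1), (tnth t j)[.
        by apply: rat_in_itvoo; rewrite ltrBlDr ltrDl.
      rewrite in_itv/= => /andP[_ qt]; exists q; split => // jE.
      by rewrite jE eqxx in ji.
    have /choice[q qP] := hq.
    exists [tuple q j | j < k] => //; rewrite tnth_mktuple (qP i).2//.
    by move=> j; rewrite /= in_itv/= andbT tnth_mktuple (qP j).1.
  case=> q _; case: ifP => // xq /(_ i); rewrite /= !in_itv/= !andbT.
  exact: le_lt_trans.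
by move=> /(_ measurableT B mB).
Qed.

Lemma orthant_measure_unique (mu nu : {measure set (Rn R k) -> \bar R}) :
  mu setT = 1%E -> nu setT = 1%E ->
  (forall q, mu (orthant q) = nu (orthant q)) ->
  forall A, measurable A -> mu A = nu A.
Proof.
move=> mu1 nu1 mn A mA; apply: (measure_unique G (fun=> setT)) => //.
- by move=> i; left.
- by apply/seteqP; split => // t _; exists 0%N.
- by move=> B [->|[q ->]]; [rewrite mu1 nu1|exact: mn].
- by move=> i; rewrite mu1 ltry.
Qed.

End orthants.

(** * The law of the observations *)

Section normal_shift.
Context (R : realType).

Definition shift_by (m : R) (x : measurableTypeR R) : measurableTypeR R := m + x.

Lemma measurable_shift_by m : measurable_fun setT (shift_by m).
Proof. exact: measurable_funD. Qed.

HB.instance Definition _ m :=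
  isMeasurableFun.Build _ _ _ _ (shift_by m) (measurable_shift_by m).

Lemma lebesgue_measure_shift (m : R) (A : set (measurableTypeR R)) :
  measurable A -> lebesgue_measure (shift_by m @^-1` A) = lebesgue_measure A.
Proof.
move=> mA.
apply/esym/(lebesgue_measure_unique (mu := pushforward lebesgue_measure (shift_by
  m))) => // X.
move=> [[a b] _ <-] /=.
transitivity (lebesgue_measure (`](a - m), (b - m)]%classic : set R)).
  rewrite !lebesgue_measure_itv/= !lte_fin ltrD2r; case: ifP => // _.
  by rewrite -!EFinB; congr EFin; lra.
rewrite [RHS]/(lebesgue_measure (shift_by m @^-1` `]a, b]%classic)).
congr lebesgue_measure; apply/seteqP; split => x; rewrite /= /shift_by !in_itv/=; lra.
Qed.

Lemma normal_prob_shift (m s : R) (A : set (measurableTypeR R)) : s != 0 ->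
  measurable A -> normal_prob 0 s (shift_by m @^-1` A) = normal_prob m s A.
Proof.
move=> s0 mA.
pose p : measurableTypeR R -> \bar R := EFin \o normal_pdf m s.
have mp : measurable_fun A p.
  apply: measurable_funTS; apply/measurable_EFinP; exact: measurable_normal_pdf.
transitivity (\int[pushforward lebesgue_measure (shift_by m)]_(x in A) p x)%E.
  have p0 : {in A, forall y, (0 <= p y)%E}.
    by move=> y _; rewrite lee_fin normal_pdf_ge0.
  rewrite (ge0_integral_pushforward (measurable_shift_by m) _ mA mp p0).
  apply: eq_integral => x _; rewrite /p /= /shift_by !normal_pdfE// /normal_fun.
  by rewrite subr0 [m + x]addrC addrK.
by apply: eq_measure_integral => B mB _; exact: lebesgue_measure_shift.
Qed.

End normal_shift.

Section observation_law.
Context (R : realType).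

Lemma measurable_observation (f : R -> R) d (Omega : measurableType d)
    (P : probability Omega R) n (eps : 'I_n -> {RV P >-> measurableTypeR R}) :
  measurable_fun setT (observation f eps).
Proof.
apply/measurable_fun_tnthP => i.
rewrite (_ : _ \o _ = shift_by (f (design R i)) \o eps i).
  exact: measurableT_comp (measurable_shift_by _) (measurable_funPT (eps i)).
by apply/funext => w; rewrite /observation /= tnth_mktuple.
Qed.

Definition design_values (f : R -> R) n : 'cV[R]_n := \col_i f (design R i).

(** It suffices to compare the laws on orthants: there independence factorises the probability over
    coordinates, and each factor is a centred normal law shifted by f(i/n). *)
Lemma observation_mvnormal (f : R -> R) d (Omega : measurableType d)
    (P : probability Omega R) n (eps : 'I_n -> {RV P >-> measurableTypeR R})
    (sigma : R) : 0 < sigma -> iid_normal eps sigma ->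
  forall A, measurable A ->
  P (observation f eps @^-1` A) = mvnormal (design_values f n) (sigma ^+ 2) A.
Proof.
move=> sigma0 [ind law] A mA.
pose Y := mfun_Sub (mem_set (measurable_observation f eps))
  : {RV P >-> Rn R n}.
apply: (@orthant_measure_unique _ _ (distribution P Y) (mvnormal _ _)
  (probability_setT _) (probability_setT _) _ A mA) => q.
pose B i : set (measurableTypeR R) := `](ratr (tnth q i) : R), +oo[%classic.
have mB i : measurable (B i) by exact: measurable_itv.
rewrite [RHS](prod_probabilityE _ mB).
pose C i := shift_by (f (design R i)) @^-1` B i.
have mC i : measurable (C i).
  by rewrite -[C i]setTI; exact: measurable_shift_by.
transitivity (P (\bigcap_(i in [set` [set: 'I_n]%SET]) (eps i @^-1` C i))).
  rewrite /distribution /pushforward; congr (P _).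
  apply/seteqP; split => w /= h i.
    by move=> _; have := h i; rewrite /observation tnth_mktuple.
  have := h i; rewrite /observation tnth_mktuple; apply.
  by rewrite /= inE.
rewrite ind//; under eq_bigl do rewrite inE; apply: eq_bigr => i _.
rewrite (_ : P _ = distribution P (eps i) (C i))// law//.
by rewrite normal_prob_shift ?mxE ?sqrtr_sqr ?gtr0_norm// gt_eqF.
Qed.

End observation_law.

(** * Posterior distribution *)

Section posterior_uniqueness.
Local Open Scope ereal_scope.
Context d (X : measurableType d) (R : realType) (k : nat).
Variables (prior : probability (Rn R k) R) (nu : probability X R).
Variables (model : Rn R k -> probability X R) (kappa : X -> probability (Rn R k) R).
(** [q] is the likelihood relative to the reference law [nu], [r] the density of the candidate
    posterior relative to the prior, [c] the marginal density of the observation; [qE] is Bayes'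
    formula. *)
Variables (q r : X -> Rn R k -> R) (c : X -> R).
Hypothesis mq : measurable_fun setT (fun z : X * Rn R k => q z.1 z.2).
Hypothesis r0 : forall y t, (0 <= r y t)%R.
Hypothesis c0 : forall y, (0 < c y)%R.
Hypothesis qE : forall y t, q y t = (c y * r y t)%R.
Hypothesis modelE : forall t B, measurable B ->
  model t B = \int[nu]_(y in B) (q y t)%:E.
Hypothesis kappaE : forall y A, measurable A ->
  kappa y A = \int[prior]_(t in A) (r y t)%:E.

Let q0 y t : (0 <= q y t)%R.
Proof. by rewrite qE mulr_ge0// ltW. Qed.

Let mq1 y : measurable_fun setT (q y).
Proof.
exact: (measurableT_comp mq (measurable_pair1 y)).
Qed.

Let mq2 t : measurable_fun setT (q ^~ t).
Proof.
exact: (measurableT_comp mq (measurable_pair2 t)).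
Qed.

Let mr y : measurable_fun setT (r y).
Proof.
rewrite (_ : r y = (fun t => (c y)^-1 * q y t)%R); first exact: measurable_funM.
by apply/funext => t; rewrite qE mulKf// gt_eqF.
Qed.

Let mass A y : measurable A ->
  \int[prior]_(t in A) (q y t)%:E = (c y)%:E * kappa y A.
Proof.
move=> mA; rewrite kappaE// -ge0_integralZl//.
- by apply: eq_integral => t _; rewrite qE EFinM.
- by apply: measurable_funTS; exact/measurable_EFinP.
- by move=> t _; rewrite lee_fin.
- by rewrite lee_fin ltW.
Qed.

Let mjoint A : measurable A ->
  measurable_fun setT (fun z : X * Rn R k => (q z.1 z.2 * \1_A z.2)%:E).
Proof.
move=> mA; apply/measurable_EFinP; apply: measurable_funM => //.
by apply: (measurableT_comp (measurable_indic _)).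
Qed.

Let mmass A : measurable A -> measurable_fun setT (fun y => (c y)%:E * kappa y A).
Proof.
move=> mA.
rewrite (_ : (fun y => _) = fubini_F prior (fun z : X * Rn R k => (q z.1 z.2 * \1_A
  z.2)%:E)).
  apply: measurable_fun_fubini_tonelli_F; first exact: mjoint.
  by move=> z; rewrite lee_fin mulr_ge0.
apply/funext => y; rewrite -mass// /fubini_F [LHS]integral_mkcond.
by apply: eq_integral => t _; rewrite epatch_indic EFinM.
Qed.

(** Tonelli for the joint density. Both sides of the posterior identity are instances: [h] the
    indicator of B, and [h] that indicator times [post y A]. *)
Let swap (h : X -> \bar R) A : measurable A -> measurable_fun setT h ->
  (forall y, 0 <= h y) ->
  \int[prior]_(t in A) \int[nu]_y (h y * (q y t)%:E) =
  \int[nu]_y (h y * ((c y)%:E * kappa y A)).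
Proof.
move=> mA mh h0.
pose phi (z : X * Rn R k) := h z.1 * (q z.1 z.2 * \1_A z.2)%:E.
have mphi : measurable_fun setT phi.
  apply: emeasurable_funM; last exact: mjoint.
  by apply: (measurableT_comp mh).
have phi0 z : 0 <= phi z by rewrite mule_ge0// lee_fin mulr_ge0.
have := fubini_tonelli (m1 := nu) (m2 := prior) phi mphi phi0.
rewrite /phi/= => E.
transitivity (\int[prior]_t \int[nu]_y (h y * (q y t * \1_A t)%:E)).
  rewrite [LHS]integral_mkcond; apply: eq_integral => t _.
  rewrite epatch_indic muleC -ge0_integralZl//.
  - by apply: eq_integral => y _; rewrite EFinM muleCA [X in _ * X]muleC.
  - by apply: emeasurable_funM => //; exact/measurable_EFinP.
  - by move=> y _; rewrite mule_ge0// lee_fin.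
  - by rewrite lee_fin.
rewrite -E; apply: eq_integral => y _.
rewrite ge0_integralZl//.
- congr (_ * _); rewrite -mass// [RHS]integral_mkcond.
  by apply: eq_integral => t _; rewrite epatch_indic EFinM.
- by apply/measurable_EFinP; apply: measurable_funM.
- by move=> t _; rewrite lee_fin mulr_ge0.
Qed.

(** For fixed A, the functions c [kappa] A and c [post] A have the same [nu]-integral over every B,
    hence agree almost everywhere, and c > 0 cancels. *)
Lemma posterior_ae_unique (post : R.-pker X ~> Rn R k) :
  is_posterior prior model post ->
  {ae nu, forall y, forall A, measurable A -> post y A = kappa y A}.
Proof.
move=> H.
have one A : measurable A -> {ae nu, forall y, kappa y A = post y A}.
  move=> mA.
  have mpost : measurable_fun setT (fun y => post y A) by exact: measurable_kernel.
  have mc : measurable_fun setT (fun y => (c y)%:E).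
    have := mmass measurableT.
    by under eq_fun do rewrite probability_setT mule1.
  have eqB B : measurable B ->
      \int[nu]_(y in B) ((c y)%:E * kappa y A) =
      \int[nu]_(y in B) (post y A * (c y)%:E).
    move=> mB; have := H A B mA mB.
    have -> : \int[prior]_(t in A) model t B =
        \int[nu]_(y in B) ((c y)%:E * kappa y A).
      transitivity (\int[prior]_(t in A) \int[nu]_y ((\1_B y)%:E * (q y t)%:E)).
        apply: eq_integral => t _; rewrite modelE// integral_mkcond.
        by apply: eq_integral => y _; rewrite epatch_indic muleC.
      rewrite swap//.
      - rewrite [RHS]integral_mkcond; apply: eq_integral => y _.
        by rewrite epatch_indic muleC.
      - by apply/measurable_EFinP; exact: measurable_indic.
    move=> ->.
    transitivity (\int[prior]_t \int[nu]_y ((\1_B y)%:E * post y A * (q y t)%:E)).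
      apply: eq_integral => t _; rewrite integral_mkcond.
      rewrite (ge0_integral_density (mq2 t) (q0 ^~ t) (modelE t)).
      - by apply: eq_integral => y _; rewrite epatch_indic [X in X * _]muleC.
      - exact/(measurable_restrictT _ mB).1/measurable_funTS.
      - by move=> y; rewrite patchE; case: ifPn.
    rewrite swap//.
    - rewrite [RHS]integral_mkcond; apply: eq_integral => y _.
      by rewrite epatch_indic probability_setT mule1 -muleA muleC.
    - apply: emeasurable_funM => //.
      by apply/measurable_EFinP; exact: measurable_indic.
  (* Passing from equal integrals to equality almost everywhere takes integrability; the total mass
     is the joint probability of theta in A, at most 1. *)
  have fint : nu.-integrable setT (fun y => (c y)%:E * kappa y A).
    apply/integrableP; split; first exact: mmass.
    under eq_integral do rewrite gee0_abs ?mule_ge0 ?lee_fin ?(ltW (c0 _))//.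
    have := @swap (cst 1) A mA (measurable_cst _) (fun=> lee01).
    under [in X in _ = X -> _]eq_integral do rewrite mul1e.
    move=> <-; apply: (@le_lt_trans _ _ (\int[prior]_(t in A) 1)).
      rewrite integral_mkcond [leRHS]integral_mkcond.
      apply: ge0_le_integralT => t; rewrite !patchE; case: ifPn => // _.
        by apply: integral_ge0 => y _; rewrite mul1e lee_fin.
      under eq_integral do rewrite mul1e.
      by rewrite -modelE// probability_setT.
    rewrite integral_cst// mul1e; apply: le_lt_trans (ltry 1).
    exact: probability_le1.
  have := integral_ae_eq measurableT fint (emeasurable_funM mpost mc)
    (fun E _ mE => eqB E mE).
  apply: filterS => y /(_ Logic.I); rewrite [RHS]muleC => yE.
  have cy : 0 < (c y)%:E by rewrite lte_fin.
  by apply/eqP; rewrite eq_le; apply/andP; split;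
    rewrite -(@lee_pmul2l _ (c y)%:E isT cy) yE.
(* The rational orthants are countably many and determine a probability, so the
   exceptional null set can be chosen independently of the event. *)
have all_q : {ae nu, forall y, forall n, forall q, unpickle n = Some q ->
    post y (orthant q) = kappa y (orthant q)}.
  apply/ae_foralln => n.
  case E : (unpickle n : option (k.-tuple rat)) => [p|].
    have := one _ (measurable_orthant p).
    by apply: filterS => y h p' [<-].
  by apply: nearW => y p'.
apply: filterS all_q => y h; apply: orthant_measure_unique.
- exact: prob_kernel.
- exact: probability_setT.
- by move=> p; apply: (h (pickle p)); rewrite pickleK.
Qed.

End posterior_uniqueness.

Section normal_posterior.
Context (R : realType) (n k : nat).
Variables (Phi : 'M[R]_(n, k)) (s2 g : R).
Hypothesis s2_gt0 : 0 < s2.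
Hypothesis g_gt0 : 0 < g.
Hypothesis n_gt0 : (0 < n)%N.
Hypothesis PhiE : Phi^T *m Phi = (n%:R)%:M.

Definition shrinkage : R := g * n%:R / (s2 + g * n%:R).

Let pv : R := shrinkage * (s2 / n%:R).

Let lse (y : Rn R n) : 'cV[R]_k := n%:R^-1 *: (Phi^T *m col_of y).

Let nR_gt0 : 0 < n%:R :> R. Proof. by rewrite ltr0n. Qed.

Let den_gt0 : 0 < s2 + g * n%:R.
Proof. by rewrite addr_gt0// mulr_gt0. Qed.

Lemma shrinkage_gt0 : 0 < shrinkage.
Proof. by rewrite divr_gt0// mulr_gt0. Qed.

Let pv_gt0 : 0 < pv.
Proof. by rewrite mulr_gt0 ?shrinkage_gt0// divr_gt0. Qed.

(** Log-likelihood of [t] relative to the parameter 0: with N(0, s2 I) as reference, the squares of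
    the observations cancel. *)
Let expo (y : Rn R n) (t : Rn R k) : R :=
  \sum_(i < n) (2 * tnth y i * (\sum_j Phi i j * tnth t j) -
                (\sum_j Phi i j * tnth t j) ^+ 2) / (2 * s2).

Let dot_adj (y : Rn R n) (t : Rn R k) :
  \sum_i tnth y i * (\sum_j Phi i j * tnth t j) =
  n%:R * \sum_j tnth t j * lse y j 0.
Proof.
under eq_bigr do rewrite mulr_sumr.
rewrite exchange_big mulr_sumr; apply: eq_bigr => j _ /=.
rewrite !mxE mulrCA mulVKf ?gt_eqF// mulr_sumr; apply: eq_bigr => i _.
by rewrite !mxE; ring.
Qed.

Let norm_Phi (t : Rn R k) :
  \sum_i (\sum_j Phi i j * tnth t j) ^+ 2 = n%:R * \sum_j tnth t j ^+ 2.
Proof.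
have : ((Phi *m col_of t)^T *m (Phi *m col_of t)) 0 0 =
    (n%:R *: ((col_of t)^T *m col_of t)) 0 0.
  by rewrite trmx_mul mulmxA -(mulmxA _ Phi^T) PhiE mul_mx_scalar -scalemxAl.
rewrite !mxE => E.
transitivity (n%:R * \sum_j (col_of t)^T 0 j * col_of t j 0).
  rewrite -E; apply: eq_bigr => i _; rewrite !mxE -expr2; congr (_ ^+ 2).
  by apply: eq_bigr => j _; rewrite !mxE.
by congr (_ * _); apply: eq_bigr => j _; rewrite !mxE.
Qed.

(** Orthogonality of the columns separates the log-likelihood over the coordinates of [t]; as the
    prior separates too, Bayes' formula becomes one-dimensional. *)
Let expoE y t : expo y t = \sum_j (2 * n%:R * tnth t j * lse y j 0
   - n%:R * tnth t j ^+ 2) / (2 * s2).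
Proof.
rewrite /expo -!mulr_suml; congr (_ / _).
rewrite !sumrB norm_Phi mulr_sumr; congr (_ - _).
transitivity (2 * (\sum_i tnth y i * (\sum_j Phi i j * tnth t j))).
  by rewrite mulr_sumr; apply: eq_bigr => i _; rewrite mulrA.
by rewrite dot_adj mulrA mulr_sumr; apply: eq_bigr => j _; rewrite mulrA.
Qed.

Let ratioE y t :
  mvnormal_ratio 0 s2 (Phi *m col_of t) s2 y = expR (expo y t).
Proof.
rewrite /mvnormal_ratio expR_sum; apply: eq_bigr => i _.
rewrite /normal_ratio divff ?gt_eqF// sqrtr1 mul1r !mxE; congr expR.
under eq_bigr do rewrite mxE.
by field; rewrite gt_eqF.
Qed.

Let mexpo : measurable_fun setT (fun z : Rn R n * Rn R k => expR (expo z.1 z.2)).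
Proof.
apply: measurableT_comp => //; apply: measurable_sum => i.
have my : measurable_fun setT (fun z : Rn R n * Rn R k => tnth z.1 i).
  exact: (measurableT_comp (measurable_tnth i)).
have mt : measurable_fun setT
    (fun z : Rn R n * Rn R k => \sum_j Phi i j * tnth z.2 j).
  apply: measurable_sum => j; apply: measurable_funM => //.
  exact: (measurableT_comp (measurable_tnth j)).
apply: measurable_funM => //; apply: measurable_funB.
  by apply: measurable_funM => //; exact: measurable_funM.
exact: measurable_funX.
Qed.

(** Completing the square in each coordinate: the precisions add up, 1/pv = 1/g + n/s2, and the mean
    is [shrinkage] times least squares. The exceptional set is null for the reference law N(0, s2
    I). *)
Lemma normal_posterior (post : R.-pker Rn R n ~> Rn R k) :
  is_posterior (mvnormal 0 g) (fun t => mvnormal (Phi *m col_of t) s2) post ->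
  {ae mvnormal 0 s2, forall y, forall A, measurable A ->
    post y A = mvnormal (shrinkage *: lse y) pv A}.
Proof.
(* The value is forced by Bayes' formula at theta = 0, where the likelihood ratio is 1. *)
pose c y := \prod_(j < k)
  ((Num.sqrt (g / pv))^-1 * expR ((shrinkage * lse y j 0) ^+ 2 / (2 * pv))).
have gpv : 0 < g / pv by rewrite divr_gt0.
apply: (@posterior_ae_unique _ _ _ _ _ _ _ (fun y => mvnormal (shrinkage *: lse y) pv)
  (fun y t => expR (expo y t)) (fun y => mvnormal_ratio 0 g (shrinkage *: lse y) pv) c).
- exact: mexpo.
- by move=> y t; exact: mvnormal_ratio_ge0.
- by move=> y; rewrite prodr_gt0// => j _;
  rewrite mulr_gt0 ?expR_gt0// invr_gt0 sqrtr_gt0.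
- move=> y t; rewrite expoE expR_sum /c /mvnormal_ratio -big_split/=.
  apply: eq_bigr => j _; rewrite /normal_ratio mulrACA mulVf ?mul1r ?gt_eqF ?sqrtr_gt0//.
  rewrite -expRD !mxE; congr expR; set l := _ * (\sum_i _).
  rewrite /pv /shrinkage; field.
  by rewrite !gt_eqF.
- by move=> t B mB; rewrite (mvnormal_density 0 _ s2_gt0 s2_gt0)//;
    apply: eq_integral => y _; rewrite ratioE.
- by move=> y A mA; exact: mvnormal_density.
Qed.

End normal_posterior.

(** * Fourier system and aliasing *)

Section fourier_mean.
Context (R : realType).
Implicit Types (m l j n : nat) (x : R).

(* The constant function of index 1 is seen as a cosine of frequency 1./2 = 0 with
   amplitude 1; the unused index 0 is a cosine of frequency 0 with amplitude sqrt 2. *)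
Definition fourier_amp j : R := if j == 1 then 1 else Num.sqrt 2.

Definition is_sine j := odd j && (j != 1).

Lemma fourierE j x : fourier j x = fourier_amp j *
  (if is_sine j then sin (2 * pi * j./2%:R * x) else cos (2 * pi * j./2%:R * x)).
Proof.
rewrite /fourier /fourier_amp /is_sine; have [->|j1] := eqVneq j 1.
  by rewrite /= mulr0 mul0r cos0 mulr1.
by rewrite andbT; case: ifP.
Qed.

(** By the product-to-sum formulas this is the mean of [fourier l x * fourier j x] when [e m] is the
    mean of the cosine of frequency m and sines have mean 0. The parameter [e] lets design points
    ([e m] = 1 iff n divides m) and the integral ([e m] = 1 iff m = 0) share one computation. *)
Definition fourier_gram (e : nat -> R) l j : R :=
  fourier_amp l * fourier_amp j *
  (if is_sine l == is_sine j then
     (e `|l./2 - j./2|%N + (-1) ^+ is_sine l * e (l./2 + j./2)%N) / 2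
   else 0).

Lemma fourier_gram_norm (e : nat -> R) l j : (forall m, 0 <= e m) ->
  `|fourier_gram e l j| <= e `|l./2 - j./2|%N + e (l./2 + j./2)%N.
Proof.
move=> e0; rewrite /fourier_gram normrM.
have amp2 : `|fourier_amp l * fourier_amp j| <= 2.
  have s2 : Num.sqrt 2 ^+ 2 = 2 :> R by rewrite sqr_sqrtr.
  have s0 : 0 <= Num.sqrt 2 :> R by exact: sqrtr_ge0.
  rewrite ger0_norm /fourier_amp; first by case: ifP; case: ifP => _ _; nra.
  by case: ifP; case: ifP => _ _; rewrite ?mulr_ge0.
have h : `|if is_sine l == is_sine j then
     (e `|l./2 - j./2|%N + (-1) ^+ is_sine l * e (l./2 + j./2)%N) / 2
   else 0| <= (e `|l./2 - j./2|%N + e (l./2 + j./2)%N) / 2.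
  have e1 := e0 `|l./2 - j./2|%N; have e2 := e0 (l./2 + j./2)%N.
  case: ifP => _; last by rewrite normr0; lra.
  rewrite ler_norml; case: is_sine; rewrite ?expr1 ?expr0; lra.
rewrite -[leRHS](@divfK _ 2)// mulrC [leRHS]mulrC.
by rewrite mulrC ler_pM.
Qed.

Lemma fourier_gram_id (e : nat -> R) l j : (0 < l)%N -> (0 < j)%N ->
  (forall m, (m <= l./2 + j./2)%N -> e m = (m == 0)%:R) ->
  fourier_gram e l j = (l == j)%:R.
Proof.
move=> l0 j0 eE; rewrite /fourier_gram !eE; last 2 first.
- by [].
- by lia.
have s2 : Num.sqrt 2 * Num.sqrt 2 = 2 :> R by rewrite -expr2 sqr_sqrtr.
have [<-|lj] := eqVneq l j.
  rewrite eqxx distnn eqxx /fourier_amp /is_sine addn_eq0 andbb.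
  (* At index 1 the amplitude is 1 and both terms have frequency 0; at larger indices the squared
     amplitude is 2 and only the difference term survives. *)
  have [->|l1] := eqVneq l 1; first by rewrite /= expr0; lra.
  rewrite (_ : (l./2 == 0)%N = false); last by lia.
  by rewrite mulr0 addr0 s2; field.
case: ifPn => [/eqP sE|_]; last by rewrite mulr0.
rewrite (_ : (`|l./2 - j./2|%N == 0%N) = false); last first.
  by apply/negbTE/eqP; move: sE lj; rewrite /is_sine; lia.
rewrite (_ : (l./2 + j./2 == 0)%N = false); last first.
  by apply/negbTE/eqP; move: sE lj; rewrite /is_sine; lia.
by rewrite mulr0 addr0 mul0r mulr0.
Qed.

(* M g u reads: u is the mean of g, either over the design points or over a period. *)
Section mean.
Variables (M : (R -> R) -> R -> Prop) (e : nat -> R).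
Hypothesis M_lin : forall a b g h u v, M g u -> M h v ->
  M (fun x => a * g x + b * h x) (a * u + b * v).
Hypothesis M_cos : forall m, M (fun x => cos (2 * pi * m%:R * x)) (e m).
Hypothesis M_sin : forall m, M (fun x => sin (2 * pi * m%:R * x)) 0.

Let dist_argE l j x : 2 * pi * l%:R * x - 2 * pi * j%:R * x =
  (if (j <= l)%N then 1 else -1) * (2 * pi * `|l - j|%:R * x).
Proof.
case: leqP => jl.
  by rewrite mul1r distnEl// natrB//; ring.
by rewrite (distnEr (ltnW jl)) (natrB _ (ltnW jl)); ring.
Qed.

Lemma fourier_mean l j : M (fun x => fourier l x * fourier j x) (fourier_gram e l j).
Proof.
have scale a g u : M g u -> M (fun x => a * g x) (a * u).
  move=> gu; have := M_lin a 0 gu gu; rewrite mul0r addr0.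
  by under eq_fun do rewrite mul0r addr0.
rewrite (_ : (fun x => _) = fun x => fourier_amp l * fourier_amp j *
    ((if is_sine l then sin (2 * pi * l./2%:R * x) else cos (2 * pi * l./2%:R * x)) *
     (if is_sine j then sin (2 * pi * j./2%:R * x) else cos (2 * pi * j./2%:R *
       x)))); last first.
  by apply/funext => x; rewrite !fourierE mulrACA.
apply: scale; set p := l./2; set q := j./2.
have argD x : 2 * pi * (p + q)%:R * x = 2 * pi * p%:R * x + 2 * pi * q%:R * x.
  by rewrite natrD; ring.
have cosd x : cos (2 * pi * `|p - q|%:R * x) =
    cos (2 * pi * p%:R * x - 2 * pi * q%:R * x).
  by rewrite dist_argE; case: ifP => _; rewrite ?mul1r// mulN1r cosN.
have sind x : sin (2 * pi * p%:R * x - 2 * pi * q%:R * x) =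
    (if (q <= p)%N then 1 else -1) * sin (2 * pi * `|p - q|%:R * x).
  by rewrite dist_argE; case: ifP => _; rewrite ?mul1r// !mulN1r sinN.
case: (is_sine l); case: (is_sine j) => /=.
- rewrite expr1.
  rewrite (_ : (fun x => _) = fun x => 2^-1 * cos (2 * pi * `|p - q|%:R * x) +
      (- 2^-1) * cos (2 * pi * (p + q)%:R * x)); last first.
    by apply/funext => x; rewrite cosd cosB argD cosD; field.
  have -> : (e `|p - q|%N + -1 * e (p + q)%N) / 2 =
    2^-1 * e `|p - q|%N + (- 2^-1) * e (p + q)%N by field.
  exact: M_lin.
- rewrite (_ : (fun x => _) = fun x => 2^-1 * sin (2 * pi * (p + q)%:R * x) +
      (2^-1 * (if (q <= p)%N then 1 else -1)) * sin (2 * pi * `|p - q|%:R * x));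
        last first.
    by apply/funext => x; rewrite argD sinD -[_ * (if _ then _ else _) * _]mulrA
      -sind sinB; field.
  by have := M_lin 2^-1 (2^-1 * (if (q <= p)%N then 1 else -1)) (M_sin (p + q))
    (M_sin `|p - q|); rewrite !mulr0 addr0.
- rewrite (_ : (fun x => _) = fun x => 2^-1 * sin (2 * pi * (p + q)%:R * x) +
      (- 2^-1 * (if (q <= p)%N then 1 else -1)) * sin (2 * pi * `|p - q|%:R * x));
        last first.
    by apply/funext => x; rewrite argD sinD -[_ * (if _ then _ else _) * _]mulrA
      -sind sinB; field.
  by have := M_lin 2^-1 (- 2^-1 * (if (q <= p)%N then 1 else -1)) (M_sin (p + q))
    (M_sin `|p - q|); rewrite !mulr0 addr0.
- rewrite expr0 mul1r.
  rewrite (_ : (fun x => _) = fun x => 2^-1 * cos (2 * pi * `|p - q|%:R * x) +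
      2^-1 * cos (2 * pi * (p + q)%:R * x)); last first.
    by apply/funext => x; rewrite cosd cosB argD cosD; field.
  have -> : (e `|p - q|%N + e (p + q)%N) / 2 =
    2^-1 * e `|p - q|%N + 2^-1 * e (p + q)%N by field.
  exact: M_lin.
Qed.

End mean.
End fourier_mean.

Section discrete_mean.
Context (R : realType) (n : nat).
Hypothesis n_gt0 : (0 < n)%N.

Let nR : n%:R != 0 :> R. Proof. by rewrite pnatr_eq0 -lt0n. Qed.

Lemma sin_pi_div_neq0 m : ~~ (n %| m)%N -> sin (pi * m%:R / n%:R) != 0 :> R.
Proof.
move=> nm.
have -> : pi * m%:R / n%:R = pi * (m %% n)%:R / n%:R + pi *+ (m %/ n) :> R.
  by rewrite -(mulr_natr pi) {1}(divn_eq m n) natrD natrM; field.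
rewrite (alternatingn (@sinDpi R)) mulf_neq0 ?signr_eq0//.
rewrite gt_eqF// sin_gt0_pi//; have r0 : (0 < m %% n)%N by rewrite lt0n.
have rn : (m %% n)%:R / n%:R < 1 :> R.
  by rewrite ltr_pdivrMr ?ltr0n// mul1r ltr_nat ltn_pmod.
rewrite -mulrA; apply/andP; split.
  by rewrite mulr_gt0 ?pi_gt0// divr_gt0 ?ltr0n.
by rewrite gtr_pMr ?pi_gt0.
Qed.

(** If n does not divide m, multiplication by 2 sin h with h = pi m / n makes the sum telescope over
    a full period, and sin h is nonzero. *)
Lemma sum_cos_design m : \sum_(i < n) cos (2 * pi * m%:R * design R i) =
  if (n %| m)%N then n%:R else 0 :> R.
Proof.
case: ifPn => nm.
  rewrite (eq_bigr (fun=> 1)) ?sumr_const ?card_ord// => i _.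
  have -> : 2 * pi * m%:R * design R i = 0 + (pi *+ 2) *+ (m %/ n * i.+1).
    rewrite add0r -mulr_natr -(mulr_natr pi 2) /design -{1}(divnK nm) !natrM.
    by field.
  by rewrite (periodicn (@cosD2pi R)) cos0.
pose h : R := pi * m%:R / n%:R.
pose S i := sin (2 * h * i%:R + h).
have E : 2 * sin h * (\sum_(i < n) cos (2 * pi * m%:R * design R i)) = 0.
  transitivity (\sum_(0 <= i < n) (S i.+1 - S i)).
    rewrite big_mkord mulr_sumr; apply: eq_bigr => i _.
    have -> : 2 * pi * m%:R * design R i = 2 * h * i.+1%:R by rewrite /h /design; field.
    rewrite /S (_ : 2 * h * i%:R + h = 2 * h * i.+1%:R - h); last first.
      by rewrite -natr1; ring.
    by rewrite sinB sinD; ring.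
  rewrite telescope_sumr// /S mulr0 add0r.
  have -> : 2 * h * n%:R + h = h + (pi *+ 2) *+ m.
    by rewrite -(mulr_natr _ m) -(mulr_natr pi 2) /h; field.
  by rewrite (periodicn (@sinD2pi R)) subrr.
move/eqP: E; rewrite mulf_eq0 mulf_eq0 (negbTE (sin_pi_div_neq0 nm)).
by rewrite pnatr_eq0 /= => /eqP.
Qed.

Lemma sum_sin_design m : \sum_(i < n) sin (2 * pi * m%:R * design R i) = 0 :> R.
Proof.
have [nm|nm] := boolP (n %| m)%N.
  rewrite big1// => i _.
  have -> : 2 * pi * m%:R * design R i = 0 + (pi *+ 2) *+ (m %/ n * i.+1).
    rewrite add0r -mulr_natr -(mulr_natr pi 2) /design -{1}(divnK nm) !natrM.
    by field.
  by rewrite (periodicn (@sinD2pi R)) sin0.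
pose h : R := pi * m%:R / n%:R.
pose S i := - cos (2 * h * i%:R + h).
have E : 2 * sin h * (\sum_(i < n) sin (2 * pi * m%:R * design R i)) = 0.
  transitivity (\sum_(0 <= i < n) (S i.+1 - S i)).
    rewrite big_mkord mulr_sumr; apply: eq_bigr => i _.
    have -> : 2 * pi * m%:R * design R i = 2 * h * i.+1%:R by rewrite /h /design; field.
    rewrite /S (_ : 2 * h * i%:R + h = 2 * h * i.+1%:R - h); last first.
      by rewrite -natr1; ring.
    by rewrite cosB cosD; ring.
  rewrite telescope_sumr// /S mulr0 add0r.
  have -> : 2 * h * n%:R + h = h + (pi *+ 2) *+ m.
    by rewrite -(mulr_natr _ m) -(mulr_natr pi 2) /h; field.
  by rewrite (periodicn (@cosD2pi R)) subrr.
move/eqP: E; rewrite mulf_eq0 mulf_eq0 (negbTE (sin_pi_div_neq0 nm)).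
by rewrite pnatr_eq0 /= => /eqP.
Qed.

Definition design_gram : nat -> nat -> R := fourier_gram (fun m => (n %| m)%N%:R).

Lemma sum_fourier_design l j :
  \sum_(i < n) fourier l (design R i) * fourier j (design R i) =
  n%:R * design_gram l j.
Proof.
apply: (@fourier_mean R (fun g u => \sum_(i < n) g (design R i) = n%:R * u)).
- move=> a b g h u v gu hv; rewrite big_split/= -!mulr_sumr gu hv; ring.
- by move=> m; rewrite sum_cos_design; case: ifP => _; rewrite ?mulr1 ?mulr0.
- by move=> m; rewrite sum_sin_design mulr0.
Qed.

(** For indices below n the two frequencies add up to less than n, so 0 is the only multiple of n in
    reach. *)
Lemma design_gram_id l j : (0 < l < n)%N -> (0 < j < n)%N ->
  design_gram l j = (l == j)%:R.
Proof.
move=> /andP[l0 ln] /andP[j0 jn]; apply: fourier_gram_id => // m mlj.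
congr (nat_of_bool _)%:R; apply/idP/eqP => [/dvdn_leq nm|->]; last exact: dvdn0.
have [->//|m0] := posnP m; have := nm m0; lia.
Qed.

Lemma design_matrix_gram k : (k < n)%N ->
  (design_matrix R n k)^T *m design_matrix R n k = (n%:R)%:M.
Proof.
move=> kn; apply/matrixP => i j; rewrite !mxE.
under eq_bigr do rewrite !mxE.
rewrite sum_fourier_design design_gram_id ?ltn0Sn ?(leq_ltn_trans (ltn_ord _))//.
by rewrite eqSS mulr_natr.
Qed.

End discrete_mean.

Section sums.
Context (R : realFieldType).

Lemma sum_cauchy_schwarz (I : Type) (r : seq I) (x y : I -> R) :
  (\sum_(i <- r) x i * y i) ^+ 2 <= (\sum_(i <- r) x i ^+ 2) * (\sum_(i <- r) y i ^+ 2).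
Proof.
elim: r => [|i r IH]; first by rewrite !big_nil expr0n mulr0.
rewrite !big_cons.
have : 0 <= \sum_(i <- r) x i ^+ 2 by apply: sumr_ge0 => *; exact: sqr_ge0.
have : 0 <= \sum_(i <- r) y i ^+ 2 by apply: sumr_ge0 => *; exact: sqr_ge0.
move: (x i) (y i) (\sum_(i <- r) x i * y i) (\sum_(i <- r) x i ^+ 2) (\sum_(i <- r) y
  i ^+ 2) IH.
move=> u v S X Y SXY Y0 X0.
have [XE|Xn0] := eqVneq X 0.
  have S0 : S = 0.
    by apply/eqP; rewrite -sqrf_eq0 eq_le sqr_ge0 andbT -(mul0r Y) -XE.
  rewrite S0 XE; nra.
have Xgt0 : 0 < X by rewrite lt_neqAle eq_sym Xn0.
have [a aE] : exists a, a = S / X by eexists.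
have SE : S = a * X by rewrite aE divfK.
have h1 : 0 <= X * (v - a * u) ^+ 2 by rewrite mulr_ge0 ?sqr_ge0.
have h2 : a ^+ 2 * X <= Y.
  rewrite -(ler_pM2l Xgt0); apply: le_trans SXY; rewrite SE.
  by rewrite le_eqVlt; apply/orP; left; apply/eqP; ring.
have h3 : 0 <= (u ^+ 2 + X) * (Y - a ^+ 2 * X).
  by rewrite mulr_ge0 ?subr_ge0// addr_ge0 ?sqr_ge0.
rewrite SE -subr_ge0.
have -> : (u ^+ 2 + X) * (v ^+ 2 + Y) - (u * v + a * X) ^+ 2 =
  X * (v - a * u) ^+ 2 + (u ^+ 2 + X) * (Y - a ^+ 2 * X) by ring.
exact: addr_ge0.
Qed.

Lemma sum_nat_le1 n (P : pred nat) i0 :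
  (forall i, (i < n)%N -> P i -> i = i0) -> \sum_(i < n) ((P i)%:R : R) <= 1.
Proof.
move=> H; apply: (@le_trans _ _ (\sum_(i < n) (val i == i0)%:R)).
  apply: ler_sum => i _; rewrite ler_nat.
  by case E : (P i) => //; rewrite (introT eqP (H i (ltn_ord i) E)).
have [i0n|i0n] := ltnP i0 n.
  rewrite (bigD1 (Ordinal i0n))//= eqxx big1 ?addr0// => i.
  by rewrite -val_eqE/= => /negbTE ->.
rewrite big1// => i _; case: eqP => // iE.
by move: (ltn_ord i); rewrite iE ltnNge i0n.
Qed.

Lemma sum_half n (F : nat -> R) :
  \sum_(i < 2 * n) F i./2 = 2 * \sum_(p < n) F p.
Proof.
rewrite -(big_mkord xpredT (fun i => F i./2)) -(big_mkord xpredT F).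
elim: n => [|n IH]; first by rewrite !big_nil// mulr0.
rewrite mulnS addnC addn2 !big_nat_recr//= IH.
have -> : (2 * n)./2 = n by lia.
have -> : uphalf (2 * n) = n by lia.
by ring.
Qed.

End sums.

Section powers.
Context (R : realType).

(* From ln x <= x - 1 at x = (j + 1) / (j + 2). *)
Lemma powR_telescope (p : R) (j : nat) : 1 < p ->
  (p - 1) * j.+2%:R `^ (- p) <= j.+1%:R `^ (1 - p) - j.+2%:R `^ (1 - p).
Proof.
move=> p1; have j0 : 0 < j.+2%:R :> R by rewrite ltr0n.
have i0 : 0 < j.+1%:R :> R by rewrite ltr0n.
have pE : - p = (1 - p) - 1 by ring.
rewrite [in leLHS]pE.
rewrite powRB; last by rewrite (gt_eqF j0) implybT.
rewrite powRr1 ?(ltW j0)//.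
have -> : j.+1%:R `^ (1 - p) = j.+2%:R `^ (1 - p) * (j.+1%:R / j.+2%:R) `^ (1 - p).
  by rewrite -powRM ?divr_ge0 ?ltW// mulrC divfK// gt_eqF.
set A := j.+2%:R `^ (1 - p); have A0 : 0 < A by exact: powR_gt0.
have -> : (p - 1) * (A / j.+2%:R) = A * ((p - 1) / j.+2%:R) by field; rewrite gt_eqF.
rewrite (_ : A * _ - A = A * ((j.+1%:R / j.+2%:R) `^ (1 - p) - 1)); last by ring.
rewrite ler_pM2l// lerBrDl.
have x0 : 0 < j.+1%:R / j.+2%:R :> R by rewrite divr_gt0.
rewrite /powR gt_eqF//.
apply: le_trans (expR_ge1Dx _); rewrite lerD2l.
have h : ln (j.+1%:R / j.+2%:R) <= - (j.+2%:R)^-1 :> R.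
  have := @le_ln1Dx R (j.+1%:R / j.+2%:R - 1).
  rewrite (_ : 1 + (j.+1%:R / j.+2%:R - 1) = j.+1%:R / j.+2%:R); last by ring.
  rewrite ltrBrDr addNr => /(_ x0) /le_trans; apply.
  have : j.+2%:R = j.+1%:R + 1 :> R by rewrite natr1.
  move: (j.+1%:R : R) (j.+2%:R : R) j0 => u v v0 vE.
  rewrite (_ : u / v - 1 = (u - v) / v); last by field; rewrite gt_eqF.
  by rewrite vE opprD addrA subrr add0r mulN1r.
have -> : (1 - p) * ln (j.+1%:R / j.+2%:R) = (p - 1) * - ln (j.+1%:R / j.+2%:R) by ring.
by rewrite ler_pM2l ?subr_gt0// lerNr.
Qed.

(** The bound is 1 + 1/(p - 1): the first term, then the telescoped remainder. *)
Lemma p_series_le (p : R) Q : 1 < p ->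
  \sum_(q < Q) q.+1%:R `^ (- p) <= p / (p - 1).
Proof.
move=> p1; have p0 : 0 < p - 1 by rewrite subr_gt0.
case: Q => [|Q]; first by rewrite big_ord0 divr_ge0//; lra.
rewrite big_ord_recl/= powR1.
have : \sum_(q < Q) (p - 1) * q.+2%:R `^ (- p) <= 1.
  apply: (@le_trans _ _ (1 - Q.+1%:R `^ (1 - p))); last by rewrite gerBl powR_ge0.
  elim: Q => [|Q IH]; first by rewrite big_ord0 powR1 subrr.
  rewrite big_ord_recr/=; have := powR_telescope Q p1; lra.
rewrite -mulr_sumr -ler_pdivlMl// mulr1 => h.
have -> : p / (p - 1) = 1 + (p - 1)^-1 by field; rewrite gt_eqF.
by rewrite lerD2l; apply: le_trans h.
Qed.

Lemma sobolev_weight_ge (alpha : R) l : 0 <= alpha ->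
  l.-1%:R `^ alpha <= sobolev_weight alpha l.
Proof.
move=> a0; rewrite /sobolev_weight; case: ifP => // _.
by rewrite ge0_ler_powR ?nnegrE// ler_nat leq_pred.
Qed.

Lemma sqr_powR (x a : R) : (x `^ a) ^+ 2 = x `^ (2 * a).
Proof. by rewrite mulrC powRrM powR_mulrn// powR_ge0. Qed.

(** It suffices that l - 1 >= n (q + 1) / 2. For q = 0 this follows from l >= n >= 2; for q >= 1
    from l >= 2nq >= n (q + 1). *)
Lemma sobolev_weight_sqr_ge (alpha : R) n l q : 0 <= alpha -> (1 < n)%N ->
  (n <= l)%N -> (2 * n * q <= l)%N ->
  (n%:R * q.+1%:R / 2) `^ (2 * alpha) <= sobolev_weight alpha l ^+ 2.
Proof.
move=> a0 n1 nl ql.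
apply: (@le_trans _ _ ((l.-1%:R `^ alpha) ^+ 2)); last first.
  by rewrite lerXn2r ?nnegrE ?powR_ge0 ?(le_trans _ (sobolev_weight_ge l a0))
    ?powR_ge0// sobolev_weight_ge.
rewrite sqr_powR ge0_ler_powR ?nnegrE ?mulr_ge0//.
rewrite ler_pdivrMr// -!natrM ler_nat.
nia.
Qed.

End powers.

(** * Counting aliases *)

Section aliasing.
Context (R : realType) (n : nat).
Hypothesis n_gt1 : (1 < n)%N.

Let n_gt0 : (0 < n)%N. Proof. exact: ltnW. Qed.

(** On the design, frequencies p and p' are indistinguishable when n divides p - p' or p + p'; the
    weight counts which of these occur. *)
Definition alias_weight l j : R :=
  (n %| `|l./2 - j./2|)%N%:R + (n %| l./2 + j./2)%N%:R.

Lemma alias_weight_ge0 l j : 0 <= alias_weight l j.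
Proof. by rewrite addr_ge0. Qed.

Lemma alias_weightC l j : alias_weight l j = alias_weight j l.
Proof. by rewrite /alias_weight distnC addnC. Qed.

Lemma design_gram_norm l j : `|design_gram R n l j| <= alias_weight l j.
Proof. exact: fourier_gram_norm. Qed.

(** A block of 2n indices contains n consecutive frequencies, each twice. One residue modulo n
    solves the difference condition and one the sum condition, whence 2 + 2. *)
Lemma sum_alias_weight_block q j :
  \sum_(i < 2 * n) alias_weight (2 * n * q + i) j <= 4.
Proof.
set m := j./2.
have h (i : 'I_(2 * n)) : (2 * n * q + i)./2 = (n * q + i./2)%N by lia.
under eq_bigr do rewrite /alias_weight h -/m.
rewrite big_split/=.
rewrite (sum_half n (fun p => (n %| `|n * q + p - m|)%N%:R)).
rewrite (sum_half n (fun p => (n %| n * q + p + m)%N%:R)).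
have h1 : \sum_(p < n) (n %| `|n * q + p - m|)%N%:R <= 1 :> R.
  apply: (@sum_nat_le1 _ _ (fun p => n %| `|n * q + p - m|)%N (m %% n)%N) => p pn.
  move=> nd; rewrite -(modn_small pn) -(modnMDl q p n) mulnC; apply/eqP.
  case: (leqP m (n * q + p)) => [le|/ltnW le].
    by rewrite eqn_mod_dvd// -distnEl.
  by rewrite eq_sym eqn_mod_dvd// -distnEr.
have h2 : \sum_(p < n) (n %| n * q + p + m)%N%:R <= 1 :> R.
  apply: (@sum_nat_le1 _ _ (fun p => n %| n * q + p + m)%N ((n - m %% n) %% n)%N) => p pn.
  rewrite -addnA dvdn_addr ?dvdn_mulr// (divn_eq m n) addnCA dvdn_addr ?dvdn_mull//.
  have rn : (m %% n < n)%N by rewrite ltn_pmod.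
  rewrite modnMDl modn_mod; move: (m %% n)%N rn => r rn /dvdnP[c E].
  have [c0|c1] : c = 0 \/ c = 1 by nia.
    have -> : r = 0 by nia. by rewrite subn0 modnn; nia.
  have [r0|r0] := posnP r; first by nia.
  by rewrite modn_small; nia.
lra.
Qed.

Lemma sum_alias_weight_row l k : (k < n)%N ->
  \sum_(j < k) alias_weight l j.+1 <= 4.
Proof.
move=> kn; apply: le_trans (sum_alias_weight_block 0 l).
under [leRHS]eq_bigr do rewrite muln0 add0n alias_weightC.
rewrite -(big_mkord xpredT (fun j => alias_weight l j)).
rewrite -(big_mkord xpredT (fun j => alias_weight l j.+1)).
rewrite [leRHS](big_cat_nat (n := k.+1))//=; last by lia.
rewrite big_nat_recl//= addrAC lerDr addr_ge0 ?alias_weight_ge0//.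
by apply: sumr_ge0 => j _; exact: alias_weight_ge0.
Qed.

Lemma design_gram_le l j : (0 < j < n)%N -> l != j -> (0 < l)%N ->
  `|design_gram R n l j| <= (n <= l)%N%:R * alias_weight l j.
Proof.
move=> jn lj l0; case: leqP => nl; first by rewrite mul1r design_gram_norm.
by rewrite mul0r design_gram_id ?l0// (negbTE lj) normr0.
Qed.

(** Cut into blocks of length 2n: block q has alias mass at most 4 and squared weights at least (n
    (q + 1) / 2)^(2 alpha), which leaves a p-series with p = 2 alpha > 1. *)
Lemma sum_alias_weight_tail (alpha : R) N j : 1 / 2 < alpha ->
  \sum_(l < N | (n <= l)%N) (sobolev_weight alpha l ^+ 2)^-1 * alias_weight l j <=
  4 * (2 * alpha / (2 * alpha - 1)) * (n%:R / 2) `^ (- (2 * alpha)).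
Proof.
move=> a12; have p1 : 1 < 2 * alpha by lra.
pose F l := (n <= l)%N%:R * ((sobolev_weight alpha l ^+ 2)^-1 * alias_weight l j).
have F0 l : 0 <= F l.
  by rewrite !mulr_ge0 ?alias_weight_ge0// invr_ge0 sqr_ge0.
(* The range is enlarged to a whole number of blocks. *)
apply: (@le_trans _ _ (\sum_(0 <= l < N * (2 * n)) F l)).
  rewrite big_mkcond/= -(big_mkord xpredT (fun l => if (n <= l)%N then
    (sobolev_weight alpha l ^+ 2)^-1 * alias_weight l j else 0)).
  rewrite [leRHS](big_cat_nat (n := N))//=; last by nia.
  rewrite -[leLHS]addr0 lerD//; last by apply: sumr_ge0.
  by apply: ler_sum => l _; rewrite /F; case: leqP => _; rewrite ?mul1r ?mul0r.
rewrite big_nat_mul big_mkord.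
have n2 : 0 < n%:R / 2 :> R by rewrite divr_gt0// ltr0n.
apply: (@le_trans _ _ (\sum_(q < N) 4 * (n%:R / 2) `^ (- (2 * alpha)) *
    q.+1%:R `^ (- (2 * alpha)))).
  apply: ler_sum => q _.
  rewrite -{1}[(q * (2 * n))%N]add0n big_addn.
  rewrite (_ : (q.+1 * (2 * n) - q * (2 * n))%N = (2 * n)%N); last by lia.
  rewrite big_mkord.
  apply: (@le_trans _ _ (\sum_(i < 2 * n) (n%:R * q.+1%:R / 2) `^ (- (2 * alpha)) *
      alias_weight (2 * n * q + i) j)).
    apply: ler_sum => i _; rewrite /F addnC (mulnC q).
    case: leqP => nl; last first.
      by rewrite mul0r mulr_ge0 ?powR_ge0 ?alias_weight_ge0.
    rewrite mul1r ler_wpM2r ?alias_weight_ge0// powRN.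
    have := @sobolev_weight_sqr_ge R alpha n (2 * n * q + i) q _ n_gt1 nl (leq_addr _ _).
    have x0 : 0 < (n%:R * q.+1%:R / 2) `^ (2 * alpha) :> R.
      by rewrite powR_gt0// divr_gt0// mulr_gt0// ltr0n.
    move=> h; rewrite lef_pV2 ?posrE//; last by apply: lt_le_trans (h _) => //; lra.
    by apply: h; lra.
  rewrite -mulr_sumr (mulrAC n%:R) powRM ?ler0n ?(ltW n2)//.
  rewrite -[leRHS]mulrA [leLHS]mulrC ler_wpM2r ?mulr_ge0 ?powR_ge0//.
  exact: sum_alias_weight_block.
rewrite -mulr_sumr mulrAC ler_wpM2r ?powR_ge0// ler_pM2l//.
exact: p_series_le.
Qed.

End aliasing.

(** * Bias of least squares on a Sobolev ellipsoid *)

Section sobolev_coefficients.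
Context (R : realType) (alpha : R) (theta : nat -> R) (A : R).
Hypothesis alpha_gt : 1 / 2 < alpha.
Hypothesis ellipsoid : forall N,
  \sum_(1 <= l < N.+1) sobolev_weight alpha l ^+ 2 * theta l ^+ 2 <= A.

Let alpha_ge0 : 0 <= alpha. Proof. by move: alpha_gt; lra. Qed.

Let alpha2_gt1 : 1 < 2 * alpha. Proof. by move: alpha_gt; lra. Qed.

Lemma ellipsoid_ge0 : 0 <= A.
Proof. by have := ellipsoid 0; rewrite big_nil. Qed.

Lemma sobolev_tail k N : (0 < k)%N ->
  \sum_(k.+1 <= l < N) theta l ^+ 2 <= A * k%:R `^ (- (2 * alpha)).
Proof.
move=> k0; have kp : 0 < k%:R `^ (2 * alpha) :> R by rewrite powR_gt0// ltr0n.
rewrite powRN ler_pdivlMr// mulr_suml.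
have [kN|Nk] := leqP k.+1 N; last first.
  by rewrite big_geq 1?ltnW// ellipsoid_ge0.
case: N kN => // N kN.
apply: le_trans (ellipsoid N); rewrite [leRHS](big_cat_nat (n := k.+1))//=.
rewrite -[leLHS]add0r lerD//.
  by apply: sumr_ge0 => l _; rewrite mulr_ge0 ?sqr_ge0.
rewrite big_nat_cond [leRHS]big_nat_cond; apply: ler_sum => l /andP[/andP[kl _] _].
rewrite mulrC ler_wpM2r ?sqr_ge0// -sqr_powR.
rewrite lerXn2r ?nnegrE ?powR_ge0//.
  by rewrite (le_trans _ (sobolev_weight_ge l alpha_ge0)) ?powR_ge0.
apply: le_trans (sobolev_weight_ge l alpha_ge0).
rewrite ge0_ler_powR ?nnegrE// ler_nat; lia.
Qed.

(** 16 is the row bound 4 times the block bound 4; the fraction is the p-series bound, and the power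
    of 2 comes from the n/2 in the column sums. *)
Definition bias_const : R := 16 * (2 * alpha / (2 * alpha - 1)) * 2 `^ (2 * alpha) * A.

Lemma bias_const_ge0 : 0 <= bias_const.
Proof.
by rewrite !mulr_ge0 ?powR_ge0 ?ellipsoid_ge0 ?invr_ge0 ?alpha_ge0 ?subr_ge0 ?(ltW
  alpha2_gt1).
Qed.

Section fixed_size.
Context (n k : nat).
Hypothesis n_gt1 : (1 < n)%N.
Hypothesis kn : (k < n)%N.

Let n_gt0 : (0 < n)%N. Proof. exact: ltnW. Qed.

(* Schur test: Cauchy-Schwarz with the Sobolev weights, then the row and column
   sums of the aliasing weights. *)
Lemma bias_truncated N : (k <= N)%N ->
  \sum_(j < k) (\sum_(1 <= l < N.+1) theta l * design_gram R n l j.+1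
                - theta j.+1) ^+ 2 <= bias_const * n%:R `^ (- (2 * alpha)).
Proof.
move=> kN.
pose e l j : R := (n <= l)%N%:R * alias_weight R n l j.
have e0 l j : 0 <= e l j by rewrite mulr_ge0 ?alias_weight_ge0.
pose Y := 4 * (2 * alpha / (2 * alpha - 1)) * (n%:R / 2) `^ (- (2 * alpha)).
have Y0 : 0 <= Y.
  by rewrite !mulr_ge0 ?powR_ge0 ?invr_ge0 ?alpha_ge0 ?subr_ge0 ?(ltW alpha2_gt1).
have colY j : \sum_(1 <= l < N.+1) (sobolev_weight alpha l ^+ 2)^-1 * e l j <= Y.
  apply: le_trans (sum_alias_weight_tail n_gt1 N.+1 j alpha_gt).
  rewrite [leRHS]big_mkcond/= -(big_mkord xpredT (fun l => if (n <= l)%N then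
    (sobolev_weight alpha l ^+ 2)^-1 * alias_weight R n l j else 0)).
  rewrite [leRHS]big_ltn// leqNgt n_gt0/= add0r.
  apply: ler_sum => l _; rewrite /e; case: leqP => _; rewrite ?mul1r//.
  by rewrite mul0r mulr0.
have rowE l : \sum_(j < k) e l j.+1 <= 4.
  rewrite -mulr_sumr; case: leqP => _; last by rewrite mul0r.
  by rewrite mul1r sum_alias_weight_row.
have bias_j (j : 'I_k) : (\sum_(1 <= l < N.+1) theta l * design_gram R n l j.+1
      - theta j.+1) ^+ 2 <=
    (\sum_(1 <= l < N.+1) sobolev_weight alpha l ^+ 2 * theta l ^+ 2 * e l j.+1) * Y.
  have -> : \sum_(1 <= l < N.+1) theta l * design_gram R n l j.+1 - theta j.+1 =
      \sum_(1 <= l < N.+1) theta l * (design_gram R n l j.+1 - (l == j.+1)%:R).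
    under [RHS]eq_bigr do rewrite mulrBr.
    rewrite sumrB; congr (_ - _).
    rewrite (bigD1_seq j.+1) ?iota_uniq//=; last first.
      by rewrite mem_index_iota ltnS; have := ltn_ord j; lia.
    by rewrite eqxx mulr1 big1 ?addr0// => l /negbTE ->; rewrite mulr0.
  (* The aliasing weight is split evenly between the two factors; the Sobolev weight goes to one and
     its inverse to the other. *)
  pose x l := sobolev_weight alpha l * `|theta l| * Num.sqrt (e l j.+1).
  pose y l := (sobolev_weight alpha l)^-1 * Num.sqrt (e l j.+1).
  apply: (@le_trans _ _ ((\sum_(1 <= l < N.+1) x l * y l) ^+ 2)).
    rewrite -real_normK ?num_real// lerXn2r ?nnegrE//.
      apply: sumr_ge0 => l _; rewrite /x /y !mulr_ge0 ?sqrtr_ge0 ?invr_ge0//;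
        exact: (le_trans (powR_ge0 _ _) (sobolev_weight_ge l alpha_ge0)).
    apply: le_trans (ler_norm_sum _ _ _) _.
    rewrite big_nat_cond [leRHS]big_nat_cond.
    apply: ler_sum => l /andP[/andP[l0 lN] _].
    have D : `|design_gram R n l j.+1 - (l == j.+1)%:R| <= e l j.+1.
      have jn : (0 < j.+1 < n)%N by rewrite (leq_ltn_trans _ kn).
      have [->|lj] := eqVneq l j.+1.
        by rewrite design_gram_id// eqxx subrr normr0.
      by rewrite subr0; apply: design_gram_le.
    (* Below n everything vanishes by discrete orthogonality. This covers l = 1, where the Sobolev
       weight is 0 and cannot be cancelled. *)
    have [nl|nl] := leqP n l; last first.
      have e00 : e l j.+1 = 0 by rewrite /e leqNgt nl mul0r.
      have -> : design_gram R n l j.+1 - (l == j.+1)%:R = 0.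
        by apply/eqP; rewrite -normr_le0 -e00.
      by rewrite mulr0 normr0 /x /y e00 sqrtr0 !mulr0.
    have wl : 0 < sobolev_weight alpha l.
      apply: lt_le_trans (sobolev_weight_ge l alpha_ge0); rewrite powR_gt0// ltr0n; lia.
    rewrite /x /y mulrACA -expr2 sqr_sqrtr// (mulrAC (sobolev_weight alpha l)) (divff
      (lt0r_neq0 wl)) mul1r normrM.
    by rewrite ler_wpM2l.
  apply: le_trans (sum_cauchy_schwarz _ _ _) _.
  apply: ler_pM.
  - by apply: sumr_ge0 => l _; rewrite sqr_ge0.
  - by apply: sumr_ge0 => l _; rewrite sqr_ge0.
  - apply: ler_sum => l _; rewrite /x !exprMn sqr_sqrtr// real_normK ?num_real//.
  - apply: le_trans (colY j.+1); apply: ler_sum => l _.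
    by rewrite /y exprMn sqr_sqrtr// exprVn.
apply: (@le_trans _ _ (\sum_(j < k) (\sum_(1 <= l < N.+1)
    sobolev_weight alpha l ^+ 2 * theta l ^+ 2 * e l j.+1) * Y)).
  by apply: ler_sum => j _.
rewrite -mulr_suml exchange_big/=.
apply: (@le_trans _ _ ((4 * A) * Y)).
  rewrite ler_wpM2r//.
  apply: (@le_trans _ _ (\sum_(1 <= l < N.+1) 4 * (sobolev_weight alpha l ^+ 2 *
    theta l ^+ 2))).
    apply: ler_sum => l _; rewrite -mulr_sumr mulrC ler_wpM2r//.
    by rewrite mulr_ge0 ?sqr_ge0.
  by rewrite -mulr_sumr ler_wpM2l.
rewrite le_eqVlt; apply/orP; left; apply/eqP.
rewrite /Y powRM ?ler0n ?invr_ge0// -[2^-1]powR_inv1// -powRrM mulN1r opprK /bias_const.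
by ring.
Qed.

Variable f : R -> R.
Hypothesis fE : forall i : 'I_n,
  (fun N => \sum_(1 <= l < N.+1) theta l * fourier l (design R i)) @ \oo
    --> f (design R i).

Definition empirical_coef j : R :=
  n%:R^-1 * \sum_(i < n) fourier j (design R i) * f (design R i).

(** The truncated bound is uniform in N, and an empirical coefficient involves finitely many points,
    so convergence at each of them passes to the limit. *)
Lemma bias_le : \sum_(j < k) (empirical_coef j.+1 - theta j.+1) ^+ 2 <=
  bias_const * n%:R `^ (- (2 * alpha)).
Proof.
have cj j : (fun N => \sum_(1 <= l < N.+1) theta l * design_gram R n l j.+1) @ \oo
    --> empirical_coef j.+1.
  rewrite (_ : (fun N => _) = fun N => n%:R^-1 * \sum_(i < n) fourier j.+1 (design R i) *
      \sum_(1 <= l < N.+1) theta l * fourier l (design R i)).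
    apply: cvgM; first exact: cvg_cst.
    apply: (cvg_big add_continuous) => // i _; apply: cvgM; first exact: cvg_cst.
    exact: fE.
  apply/funext => N; under [X in _ = _ * X]eq_bigr do rewrite mulr_sumr.
  rewrite exchange_big/= mulr_sumr; apply: eq_bigr => l _.
  rewrite (eq_bigr (fun i : 'I_n => theta l * (fourier l (design R i) * fourier j.+1
    (design R i)))).
    by rewrite -mulr_sumr sum_fourier_design// [RHS]mulrCA (mulKf (lt0r_neq0 _))// ltr0n.
  by move=> i _; ring.
have c : (fun N => \sum_(j < k) (\sum_(1 <= l < N.+1) theta l * design_gram R n l j.+1
                - theta j.+1) ^+ 2) @ \oo -->
    \sum_(j < k) (empirical_coef j.+1 - theta j.+1) ^+ 2.
  apply: (cvg_big add_continuous) => // j _.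
  have h := cvgB (cj j) (cvg_cst (theta j.+1)).
  exact: cvgM (h _ _) (h _ _).
apply: (cvgr_to_le c).
by exists k => // N /= kN; exact: bias_truncated.
Qed.

End fixed_size.
End sobolev_coefficients.

(** * The L2 distance *)

Section continuous_mean.
Context (R : realType).

(** This encodes that g has integral u over [0, 1]. It is linear in (g, u) without integrability
    side conditions, so the fundamental theorem of calculus is needed only for the final
    trigonometric sum. *)
Definition periodic_primitive (g : R -> R) (u : R) :=
  exists F : R -> R, (forall x, is_derive x (1 : R) F (g x - u)) /\ F 1 = F 0.

Lemma periodic_primitive_lin a b g h u v :
  periodic_primitive g u -> periodic_primitive h v ->
  periodic_primitive (fun x => a * g x + b * h x) (a * u + b * v).
Proof.
move=> [F [dF F1]] [H [dH H1]]; exists (fun x => a * F x + b * H x).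
split; last by rewrite F1 H1.
move=> x; have dFx := dF x; have dHx := dH x.
have -> : a * g x + b * h x - (a * u + b * v) = a *: (g x - u) + b *: (h x - v).
  by rewrite /GRing.scale/=; ring.
exact: is_deriveD.
Qed.

Let is_derive_lin (c x : R) : is_derive x (1 : R) (fun y => c * y) c.
Proof. by apply: is_derive_eq; rewrite /GRing.scale/= mulr1. Qed.

Lemma periodic_primitive_cos m :
  periodic_primitive (fun x => cos (2 * pi * m%:R * x)) (m == 0)%:R.
Proof.
have [->|m0] := eqVneq m 0%N.
  exists (fun=> 0); split => // x.
  by rewrite mulr0 mul0r cos0 subrr; exact: is_derive_cst.
set c := 2 * pi * m%:R; have c0 : c != 0.
  by rewrite !mulf_neq0 ?gt_eqF ?pi_gt0// ltr0n lt0n.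
exists (fun x => c^-1 * sin (c * x)); split => [x|].
  have h := is_derive_lin c x.
  have h2 : is_derive x (1 : R) (fun y => sin (c * y)) (cos (c * x) * c).
    exact: is_derive1_comp.
  rewrite subr0 (_ : cos (c * x) = c^-1 *: (cos (c * x) * c)); first exact: is_deriveZ.
  by rewrite /GRing.scale/= mulrCA mulVf// mulr1.
rewrite mulr1 mulr0 (_ : c = 0 + (pi *+ 2) *+ m); last first.
  by rewrite -(mulr_natr _ m) -(mulr_natr pi 2) /c; ring.
by rewrite (periodicn (@sinD2pi R)).
Qed.

Lemma periodic_primitive_sin m :
  periodic_primitive (fun x => sin (2 * pi * m%:R * x)) 0.
Proof.
have [->|m0] := eqVneq m 0%N.
  exists (fun=> 0); split => // x.
  by rewrite mulr0 mul0r sin0 subrr; exact: is_derive_cst.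
set c := 2 * pi * m%:R; have c0 : c != 0.
  by rewrite !mulf_neq0 ?gt_eqF ?pi_gt0// ltr0n lt0n.
exists (fun x => (- c^-1) * cos (c * x)); split => [x|].
  have h := is_derive_lin c x.
  have h2 : is_derive x (1 : R) (fun y => cos (c * y)) (- sin (c * x) * c).
    exact: is_derive1_comp.
  rewrite subr0 (_ : sin (c * x) = (- c^-1) *: (- sin (c * x) * c));
    first exact: is_deriveZ.
  by rewrite /GRing.scale/=; field.
rewrite mulr1 mulr0 {2}(_ : c = 0 + (pi *+ 2) *+ m); last first.
  by rewrite -(mulr_natr _ m) -(mulr_natr pi 2) /c; ring.
by rewrite (periodicn (@cosD2pi R)).
Qed.

Lemma periodic_primitive_scale a g u : periodic_primitive g u ->
  periodic_primitive (fun x => a * g x) (a * u).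
Proof.
move=> gu; have := periodic_primitive_lin a 0 gu gu; rewrite mul0r addr0.
by under eq_fun do rewrite mul0r addr0.
Qed.

Lemma periodic_primitive_sum_cond (I : Type) (r : seq I) (P : pred I)
    (g : I -> R -> R) (u : I -> R) :
  (forall i, P i -> periodic_primitive (g i) (u i)) ->
  periodic_primitive (fun x => \sum_(i <- r | P i) g i x) (\sum_(i <- r | P i) u i).
Proof.
move=> h; elim: r => [|i r IH].
  rewrite big_nil; under eq_fun do rewrite big_nil.
  exists (fun=> 0); split => // x; rewrite subrr; exact: is_derive_cst.
rewrite big_cons; under eq_fun do rewrite big_cons.
case: ifPn => // Pi.
have := periodic_primitive_lin 1 1 (h i Pi) IH; rewrite !mul1r.
by under eq_fun do rewrite !mul1r.
Qed.

Lemma periodic_primitive_fourier l j : (0 < l)%N -> (0 < j)%N ->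
  periodic_primitive (fun x => fourier l x * fourier j x) (l == j)%:R.
Proof.
move=> l0 j0; rewrite -(@fourier_gram_id R (fun m => (m == 0)%:R) l j)//.
apply: fourier_mean; first exact: periodic_primitive_lin.
- exact: periodic_primitive_cos.
- exact: periodic_primitive_sin.
Qed.

Lemma continuous_fourier j : continuous (fourier j : R -> R).
Proof.
rewrite (funext (fourierE j)) => x; rewrite /continuous_at; apply: cvgM;
  first exact: cvg_cst.
have c : {for x, continuous (fun y : R => 2 * pi * j./2%:R * y)}.
  by apply: cvgM; [exact: cvg_cst|exact: cvg_id].
case: ifP => _.
  exact: (continuous_comp c (@continuous_sin _ _)).
exact: (continuous_comp c (@continuous_cos _ _)).
Qed.

Lemma continuous_trig_sum (I : Type) (r : seq I) (a : I -> R) (b : I -> nat) :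
  continuous (fun x : R => \sum_(l <- r) a l * fourier (b l) x).
Proof.
move=> x; apply: (cvg_big add_continuous) => // l _.
by apply: cvgM; [exact: cvg_cst|exact: continuous_fourier].
Qed.

(** Parseval for a trigonometric polynomial: expand the square and use orthonormality. *)
Lemma trig_sum_sqr_primitive (c : nat -> R) N :
  periodic_primitive (fun x => (\sum_(1 <= l < N) c l * fourier l x) ^+ 2)
    (\sum_(1 <= l < N) c l ^+ 2).
Proof.
pose g i (x : R) := \sum_(1 <= j < N) c i * c j * (fourier i x * fourier j x).
rewrite (_ : (fun x => _) = fun x => \sum_(1 <= i < N) g i x); last first.
  apply/funext => x; rewrite expr2 mulr_suml; apply: eq_bigr => i _.
  by rewrite mulr_sumr; apply: eq_bigr => j _; ring.
(* The range condition is kept because orthonormality requires positive indices. *)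
rewrite big_nat_cond; under eq_fun do rewrite big_nat_cond.
apply: periodic_primitive_sum_cond => i /andP[/andP[i0 iN] _].
have -> : c i ^+ 2 = \sum_(1 <= j < N) c i * c j * (i == j)%:R.
  rewrite (bigD1_seq i) ?iota_uniq ?mem_index_iota ?i0//= eqxx mulr1 big1 ?addr0//.
  by move=> j /negbTE; rewrite eq_sym => ->; rewrite mulr0.
rewrite /g big_nat_cond; under eq_fun do rewrite big_nat_cond.
apply: periodic_primitive_sum_cond => j /andP[/andP[j0 jN] _].
apply: periodic_primitive_scale; exact: periodic_primitive_fourier.
Qed.

Lemma integral_periodic_primitive (g : R -> R) (u : R) :
  continuous g -> periodic_primitive g u ->
  (\int[lebesgue_measure]_(x in `[0%R, 1%R]) (g x)%:E = u%:E)%E.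
Proof.
move=> cg [F [dF F1]].
have dG x : is_derive x (1 : R) (fun y => F y + u * y) (g x).
  have h := is_derive_lin u x; have h2 := dF x.
  by rewrite -[g x](subrK u); exact: is_deriveD.
have cG : continuous (fun y => F y + u * y).
  move=> x; apply: differentiable_continuous; apply/derivable1_diffP.
  by have [] := dG x.
rewrite (@continuous_FTC2 _ g (fun y => F y + u * y))//.
- by rewrite -EFinB F1; congr EFin; ring.
- exact: continuous_subspaceT.
- split.
  + by move=> x _; have [] := dG x.
  + by apply: cvg_at_right_filter; exact: cG.
  + by apply: cvg_at_left_filter; exact: cG.
- by move=> x _; rewrite derive1E; have [_ ->] := dG x.
Qed.

End continuous_mean.

Section L2_distance.
Context (R : realType).

Lemma L2norm01E (g : R -> R) : L2norm01 g =
  sqrte (\int[lebesgue_measure]_(x in `[0%R, 1%R]) ((g x) ^+ 2)%:E)%E.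
Proof.
rewrite /L2norm01 unlock /Lnorm poweR12_sqrt; last first.
  by apply: integral_ge0 => x _; exact: poweR_ge0.
congr sqrte; rewrite [RHS]integral_mkcond; apply: eq_integral => x _.
rewrite /= !patchE; case: ifPn => _; rewrite /= ?normr0 ?poweR_EFin.
  by rewrite powR_mulrn// real_normK// num_real.
by rewrite powR0.
Qed.

Lemma le_L2norm01 (r : R) (g : R -> R) : 0 <= r ->
  (r%:E <= L2norm01 g)%E =
  ((r ^+ 2)%:E <= \int[lebesgue_measure]_(x in `[0%R, 1%R]) ((g x) ^+ 2)%:E)%E.
Proof.
move=> r0; rewrite L2norm01E.
have : (0 <= \int[lebesgue_measure]_(x in `[0%R, 1%R]) ((g x) ^+ 2)%:E)%E.
  by apply: integral_ge0 => x _; rewrite lee_fin sqr_ge0.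
move: (\int[_]_(x in _) _)%E => [x| |]//=; last by rewrite !leey.
rewrite !lee_fin => x0.
by rewrite -[r in LHS]ger0_norm// -sqrtr_sqr ler_sqrt.
Qed.

Section approximation.
Context (alpha : R) (theta : nat -> R) (A : R) (f : R -> R) (k : nat).
Hypothesis alpha_gt : 1 / 2 < alpha.
Hypothesis ellipsoid : forall N,
  \sum_(1 <= l < N.+1) sobolev_weight alpha l ^+ 2 * theta l ^+ 2 <= A.
Hypothesis fE : forall x, x \in `[0, 1] ->
  (fun N => \sum_(1 <= l < N.+1) theta l * fourier l x) @ \oo --> f x.
Hypothesis k_gt0 : (0 < k)%N.

(** An inequality suffices, so Parseval for the partial sums followed by Fatou avoids exchanging
    limit and integral. *)
Lemma integral_sqr_sub_le (t : Rn R k) :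
  (\int[lebesgue_measure]_(x in `[0%R, 1%R]) ((f_of t x - f x) ^+ 2)%:E <=
   (\sum_(j < k) (tnth t j - theta j.+1) ^+ 2 + A * k%:R `^ (- (2 * alpha)))%:E)%E.
Proof.
(* Coefficients of f_t - f: Fourier indices start at 1 and tuple positions at 0. Truncating at N + k
   keeps all k coordinates of [t] in every partial sum. *)
pose c l := (if (l <= k)%N then nth 0 t l.-1 else 0) - theta l.
pose h N x : R := \sum_(1 <= l < (N + k).+1) c l * fourier l x.
have hE N x : h N x = f_of t x - \sum_(1 <= l < (N + k).+1) theta l * fourier l x.
  rewrite /h; under eq_bigr do rewrite mulrBl.
  rewrite sumrB; congr (_ - _).
  rewrite (big_cat_nat (n := k.+1))//=; last by rewrite ltnS leq_addl.
  rewrite [X in _ + X]big_nat_cond [X in _ + X]big1 ?addr0; last first.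
    by move=> l /andP[/andP[kl _] _]; rewrite leqNgt kl mul0r.
  rewrite big_add1/= big_mkord /f_of; apply: eq_bigr => j _.
  by rewrite ltn_ord (tnth_nth 0).
have hint N : (\int[lebesgue_measure]_(x in `[0%R, 1%R]) ((h N x) ^+ 2)%:E =
    (\sum_(1 <= l < (N + k).+1) c l ^+ 2)%:E)%E.
  apply: integral_periodic_primitive; last exact: trig_sum_sqr_primitive.
  move=> x; apply: cvgM; exact: continuous_trig_sum.
have hbound N : \sum_(1 <= l < (N + k).+1) c l ^+ 2 <=
    \sum_(j < k) (tnth t j - theta j.+1) ^+ 2 + A * k%:R `^ (- (2 * alpha)).
  rewrite (big_cat_nat (n := k.+1))//=; last by rewrite ltnS leq_addl.
  apply: lerD.
    rewrite big_add1/= big_mkord; apply: ler_sum => j _.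
    by rewrite /c ltn_ord (tnth_nth 0).
  apply: le_trans (sobolev_tail alpha_gt ellipsoid (N + k).+1 k_gt0).
  rewrite big_nat_cond [leRHS]big_nat_cond; apply: ler_sum => l /andP[/andP[kl _] _].
  by rewrite /c leqNgt kl/= sub0r sqrrN.
have hcvg x : x \in `[0, 1] -> (fun N => ((h N x) ^+ 2)%:E) @ \oo -->
    ((f_of t x - f x) ^+ 2)%:E.
  move=> x01; apply: cvg_EFin; first exact: nearW.
  have cx : (fun N => h N x) @ \oo --> f_of t x - f x.
    under eq_fun do rewrite hE.
    apply: cvgB; first exact: cvg_cst.
    have := fE x01; rewrite -(cvg_shiftn k); exact.
  exact: (cvg_comp _ (fun y : R => y ^+ 2) cx (@sqr_continuous _ _)).
apply: (@le_trans _ _ (limn_einf (fun N =>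
    \int[lebesgue_measure]_(x in `[0%R, 1%R]) ((h N x) ^+ 2)%:E)%E)).
  have -> : (\int[lebesgue_measure]_(x in `[0%R, 1%R]) ((f_of t x - f x) ^+ 2)%:E =
      \int[lebesgue_measure]_(x in `[0%R, 1%R])
        limn_einf (fun N => ((h N x) ^+ 2)%:E))%E.
    apply: eq_integral => x; rewrite inE/= => x01.
    have cx := hcvg _ x01.
    rewrite is_cvg_limn_einfE; last by apply/cvg_ex; eexists; exact: cx.
    by apply/esym/cvg_lim.
  apply: (@fatou _ _ _ lebesgue_measure _ _ (fun N x => ((h N x) ^+ 2)%:E)) => //.
    move=> N; apply/measurable_EFinP; apply: measurable_funX.
    apply: measurable_funTS; apply: continuous_measurable_fun.
    exact: continuous_trig_sum.
  by move=> N x _; rewrite lee_fin sqr_ge0.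
rewrite limn_einf_lim; apply: lime_le; first exact: is_cvg_einfs.
apply: nearW => N; apply: (@le_trans _ _
    (\int[lebesgue_measure]_(x in `[0%R, 1%R]) ((h N x) ^+ 2)%:E)%E).
  by apply: ereal_inf_lbound; exists N => //=.
by rewrite hint lee_fin.
Qed.

Lemma measurable_sobolev : measurable_fun (`[0, 1]%classic : set R) f.
Proof.
apply: (measurable_fun_cvg (h := fun N x => \sum_(1 <= l < N.+1) theta l * fourier l x)).
  move=> N; apply: measurable_funTS; apply: continuous_measurable_fun.
  exact: continuous_trig_sum.
by move=> x x01; exact: fE.
Qed.

(** The squared norm is a partial integral of a jointly measurable function, to which Tonelli
    applies; [f] is cut off to [0, 1] because it is arbitrary elsewhere. *)
Lemma measurable_L2norm01_ge (r : R) : 0 <= r -> measurable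
  [set t : Rn R k | (r%:E <= L2norm01 (fun x => f_of t x - f x)%R)%E].
Proof.
move=> r0; under eq_set do rewrite le_L2norm01//.
pose D : set (measurableTypeR R) := `[0, 1]%classic.
pose phi (z : Rn R k * measurableTypeR R) : \bar R :=
  ((f_of z.1 z.2 * \1_D z.2 - (f \_ D) z.2) ^+ 2)%:E.
have mD : measurable D by exact: measurable_itv.
have mfD : measurable_fun setT (f \_ D).
  apply: (measurable_restrictT _ mD).1; exact: measurable_sobolev.
have mphi : measurable_fun setT phi.
  apply/measurable_EFinP; apply: measurable_funX; apply: measurable_funB.
    apply: measurable_funM.
      apply: measurable_sum => j; apply: measurable_funM.
        exact: (measurableT_comp (measurable_tnth j)).
      have mfj : measurable_fun setT (fourier j.+1 : R -> R).
        by apply: continuous_measurable_fun; exact: continuous_fourier.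
      exact: (measurableT_comp mfj).
    exact: (measurableT_comp (measurable_indic mD)).
  exact: (measurableT_comp mfD).
have phi0 z : (0 <= phi z)%E by rewrite lee_fin sqr_ge0.
have := measurable_fun_fubini_tonelli_F (m2 := lebesgue_measure) phi mphi phi0.
move=> mF; have := emeasurable_fun_c_infty measurableT mF (r ^+ 2)%:E; rewrite setTI.
congr measurable; apply/seteqP; split => t /=; rewrite (_ : fubini_F _ _ _ =
    \int[lebesgue_measure]_(x in `[0%R, 1%R]) ((f_of t x - f x) ^+ 2)%:E)%E//;
  rewrite [RHS]integral_mkcond; apply: eq_integral => x _;
  rewrite /phi/= !patchE/= indicE -/D; case: ifPn => _;
  by rewrite ?mulr1// mulr0 subrr expr0n.
Qed.

End approximation.
End L2_distance.

(** * Total variation and risk bounds *)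

Section shrunk_normal.
Context (R : realType).

Lemma normal_ratio_shrink (m v s x : R) : 0 < v -> 0 < s ->
  normal_ratio m v (s * m) (s * v) x =
  expR (- (ln s / 2 + ((1 - s) / (2 * s * v) * (x - m) ^+ 2 +
    (1 - s) * m / (s * v) * (x - m) + (1 - s) ^+ 2 * m ^+ 2 / (2 * s * v)))).
Proof.
move=> v0 s0; rewrite /normal_ratio.
have -> : Num.sqrt (v / (s * v)) = expR (- (ln s / 2)).
  have -> : v / (s * v) = s^-1 by field; rewrite !gt_eqF.
  rewrite -powR12_sqrt ?invr_ge0 ?ltW// /powR invr_eq0 gt_eqF// lnV ?posrE//.
  by congr expR; rewrite mulrN mulrC.
rewrite -expRD; congr expR; field.
by rewrite !gt_eqF.
Qed.

Lemma measurable_sum_sqr n (m : 'cV[R]_n) :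
  measurable_fun setT (fun t : Rn R n => \sum_i (tnth t i - m i 0) ^+ 2).
Proof.
apply: measurable_sum => i; apply: measurable_funX.
by apply: measurable_funB => //; exact: measurable_tnth.
Qed.

(** Here [n] is the dimension of the parameter. [U] splits into constants, a multiple of the squared
    distance to [m], and a centred linear form, each bounded in mean. *)
Lemma tv_dist_shrunk_mvnormal n (m : 'cV[R]_n) (v s : R) :
  0 < v -> 1 / 2 <= s -> s < 1 ->
  (tv_dist (mvnormal (s *: m) (s * v)) (mvnormal m v) <=
   ((1 + gaussK R) * n%:R * (1 - s) + (1 - s) / Num.sqrt v +
    (2 * gaussK R * ((1 - s) / Num.sqrt v) + ((1 - s) / Num.sqrt v) ^+ 2) *
    \sum_i m i 0 ^+ 2)%:E)%E.
Proof.
move=> v0 s12 s1; have s0 : 0 < s by lra.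
have d0 : 0 < 1 - s by lra.
set K := gaussK R; have K0 : 0 <= K := gaussK_ge0 R.
set D := (1 - s) / Num.sqrt v.
have D0 : 0 < D by rewrite divr_gt0// sqrtr_gt0.
have D2 : D ^+ 2 = (1 - s) ^+ 2 / v by rewrite expr_div_n sqr_sqrtr// ltW.
pose S (t : Rn R n) := \sum_i (tnth t i - m i 0) ^+ 2.
pose W (t : Rn R n) := \sum_i ((1 - s) * m i 0 / (s * v)) * (tnth t i - m i 0).
set M := \sum_i m i 0 ^+ 2.
have M0 : 0 <= M by apply: sumr_ge0 => i _; exact: sqr_ge0.
pose U t := n%:R * (ln s / 2) + ((1 - s) / (2 * s * v) * S t + W t +
  (1 - s) ^+ 2 / (2 * s * v) * M).
have mS : measurable_fun setT S by exact: measurable_sum_sqr.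
have mW : measurable_fun setT W by exact: measurable_linear_form.
have mU : measurable_fun setT U.
  apply: measurable_funD => //; apply: measurable_funD => //.
  by apply: measurable_funD => //; exact: measurable_funM.
apply: (@le_trans _ _ (\int[mvnormal m v]_t `|U t|%:E)%E).
  apply: tv_dist_le_density => // A mA.
  rewrite (@mvnormal_density R n m v)//; last by rewrite mulr_gt0.
  apply: eq_integral => t _; congr EFin.
  rewrite /mvnormal_ratio; under eq_bigr do rewrite mxE normal_ratio_shrink//.
  rewrite -expR_sum; congr expR.
  rewrite sumrN big_split/= sumr_const card_ord !big_split/= -!mulr_sumr.
  rewrite /U /S /W /M; congr (- (_ + (_ + _))); first by rewrite mulr_natl.
  by rewrite mulr_sumr; apply: eq_bigr => i _; ring.
(* With s >= 1/2 this yields |ln s| <= 2 (1 - s), the cost of the change of scale per coordinate. *)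
have lns : `|ln s| <= (1 - s) / s.
  rewrite ler0_norm; last by rewrite ln_le0// ltW.
  rewrite -lnV ?posrE//.
  have := @le_ln1Dx R (s^-1 - 1); rewrite (_ : 1 + (s^-1 - 1) = s^-1); last by ring.
  rewrite ltrBrDr addNr invr_gt0 => /(_ s0) /le_trans; apply.
  by rewrite le_eqVlt; apply/orP; left; apply/eqP; field; rewrite gt_eqF.
have sV : s^-1 <= 2 by rewrite -[2]invrK lef_pV2 ?posrE ?invr_gt0//; lra.
pose c0 := n%:R * (1 - s) + D / 2 + D ^+ 2 * M.
have c00 : 0 <= c0.
  by rewrite !addr_ge0// ?mulr_ge0 ?divr_ge0 ?sqr_ge0 ?(ltW d0) ?(ltW D0).
have Ule t : `|U t| <= c0 + ((1 - s) / v * S t + (2 * D)^-1 * W t ^+ 2).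
  have S0 : 0 <= S t by apply: sumr_ge0 => i _; exact: sqr_ge0.
  have h1 : `|n%:R * (ln s / 2)| <= n%:R * (1 - s).
    have l2 : `|ln s| <= (1 - s) * 2.
      by apply: le_trans lns _; rewrite ler_wpM2l// ltW.
    have l3 : `|ln s / 2| <= 1 - s.
      by rewrite normrM [X in _ * X]ger0_norm// ler_pdivrMr.
    by rewrite normrM [X in X * _]ger0_norm// ler_wpM2l.
  have h2 : `|(1 - s) / (2 * s * v) * S t| <= (1 - s) / v * S t.
    rewrite ger0_norm; last by rewrite mulr_ge0// divr_ge0 ?(ltW d0)// !mulr_ge0// ltW.
    rewrite ler_wpM2r// ler_wpM2l ?(ltW d0)// lef_pV2 ?posrE ?mulr_gt0//; nra.
  (* Arithmetic-geometric mean with parameter D: as W^2 has mean of order D^2 M, both terms are of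
     order D. *)
  have h3 : `|W t| <= D / 2 + (2 * D)^-1 * W t ^+ 2.
    rewrite -[W t ^+ 2]real_normK ?num_real//; move: (`|W t|) => w.
    rewrite -subr_ge0 (_ : _ - _ = (2 * D)^-1 * (w - D) ^+ 2).
      by rewrite mulr_ge0 ?sqr_ge0// invr_ge0 mulr_ge0// ltW.
    by field; rewrite gt_eqF.
  have h4 : `|(1 - s) ^+ 2 / (2 * s * v) * M| <= D ^+ 2 * M.
    rewrite ger0_norm; last by rewrite mulr_ge0// divr_ge0 ?sqr_ge0// !mulr_ge0// ltW.
    rewrite ler_wpM2r// D2 ler_wpM2l ?sqr_ge0// lef_pV2 ?posrE ?mulr_gt0//; nra.
  rewrite /U; apply: le_trans (ler_normD _ _) _.
  have := ler_normD ((1 - s) / (2 * s * v) * S t + W t) ((1 - s) ^+ 2 / (2 * s * v) * M).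
  have := ler_normD ((1 - s) / (2 * s * v) * S t) (W t).
  rewrite /c0; lra.
have mWV : measurable_fun setT (fun t => (W t ^+ 2)%:E).
  by apply/measurable_EFinP; exact: measurable_funX.
have mSE : measurable_fun setT (fun t => (S t)%:E) by exact/measurable_EFinP.
have S0 t : (0 <= (S t)%:E)%E.
  by rewrite lee_fin; apply: sumr_ge0 => i _; exact: sqr_ge0.
have W0 t : (0 <= (W t ^+ 2)%:E)%E by rewrite lee_fin sqr_ge0.
have a0 : 0 <= (1 - s) / v by rewrite divr_ge0// ltW.
have b0 : 0 <= (2 * D)^-1 by rewrite invr_ge0 mulr_ge0// ltW.
apply: (@le_trans _ _ (\int[mvnormal m v]_t (c0%:E +
    (((1 - s) / v)%:E * (S t)%:E + (2 * D)^-1%:E * (W t ^+ 2)%:E)))%E).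
  apply: ge0_le_integralT => t; first by rewrite lee_fin.
  by rewrite -!EFinM -!EFinD lee_fin.
have mS' : measurable_fun setT (fun t => ((1 - s) / v)%:E * (S t)%:E)%E.
  exact: measurable_funeM.
have mW' : measurable_fun setT (fun t => (2 * D)^-1%:E * (W t ^+ 2)%:E)%E.
  exact: measurable_funeM.
have S'0 t : (0 <= ((1 - s) / v)%:E * (S t)%:E)%E by rewrite mule_ge0.
have W'0 t : (0 <= (2 * D)^-1%:E * (W t ^+ 2)%:E)%E by rewrite mule_ge0.
rewrite ge0_integralD//; [|by move=> t _; exact: adde_ge0|exact: emeasurable_funD].
rewrite integral_cst// [X in (_ * X)%E]probability_setT mule1.
rewrite ge0_integralD//.
rewrite !ge0_integralZl//; try by rewrite lee_fin.
have hS := mvnormal_sum_sqr_le m v0.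
have hW := mvnormal_sqr_le m (fun i => (1 - s) * m i 0 / (s * v)) v0.
apply: (@le_trans _ _ (c0%:E + (((1 - s) / v)%:E * (K * v * n%:R)%:E +
   (2 * D)^-1%:E * (K * v * \sum_i ((1 - s) * m i 0 / (s * v)) ^+ 2)%:E))%E).
  by rewrite leeD2l// leeD// lee_wpmul2l// lee_fin.
rewrite -!EFinM -!EFinD lee_fin.
have -> : \sum_i ((1 - s) * m i 0 / (s * v)) ^+ 2 = (1 - s) ^+ 2 / (s * v) ^+ 2 * M.
  by rewrite mulr_sumr; apply: eq_bigr => i _; rewrite -exprVn -!exprMn;
    congr (_ ^+ 2); ring.
have -> : (2 * D)^-1 * (K * v * ((1 - s) ^+ 2 / (s * v) ^+ 2 * M)) =
    K * M / 2 * D * s^-1 ^+ 2.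
  have -> : (1 - s) ^+ 2 / (s * v) ^+ 2 = D ^+ 2 / (s ^+ 2 * v).
    by rewrite D2; field; rewrite !gt_eqF.
  by field; rewrite !gt_eqF.
have -> : (1 - s) / v * (K * v * n%:R) = K * n%:R * (1 - s) by field; rewrite gt_eqF.
have : K * M / 2 * D * s^-1 ^+ 2 <= K * M / 2 * D * 4.
  rewrite ler_wpM2l//; first by rewrite !mulr_ge0// ltW.
  have : 0 < s^-1 by rewrite invr_gt0.
  nra.
rewrite /c0; lra.
Qed.

End shrunk_normal.

Section observation_integral.
Context (R : realType).

Lemma ge0_integral_observation (f : R -> R) d (Omega : measurableType d)
    (P : probability Omega R) n (eps : 'I_n -> {RV P >-> measurableTypeR R})
    (sigma : R) : 0 < sigma -> iid_normal eps sigma ->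
  forall g : Rn R n -> \bar R, measurable_fun setT g -> (forall y, 0 <= g y)%E ->
  (\int[P]_w g (observation f eps w) =
   \int[mvnormal (design_values f n) (sigma ^+ 2)]_y g y)%E.
Proof.
move=> sigma0 iid g mg g0.
pose Y := mfun_Sub (mem_set (measurable_observation f eps))
  : {RV P >-> Rn R n}.
rewrite -[LHS](ge0_integral_distribution Y mg g0).
apply: eq_measure_integral => A mA _.
exact: (observation_mvnormal f sigma0 iid mA).
Qed.

(** Carries the exceptional set of the posterior from the reference law to the law of Y under f. *)
Lemma mvnormal_null n (m m' : 'cV[R]_n) (v v' : R) (N : set (Rn R n)) :
  0 < v -> 0 < v' -> measurable N -> mvnormal m v N = 0%E -> mvnormal m' v' N = 0%E.
Proof.
move=> v0 v'0 mN N0; rewrite (mvnormal_density m m' v0 v'0 mN).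
apply: null_set_integral => //; apply: measurable_funTS.
by apply/measurable_EFinP; exact: measurable_mvnormal_ratio.
Qed.

End observation_integral.

Section least_squares_risk.
Context (R : realType).

Lemma least_squaresE n k (y : Rn R n) : (k < n)%N ->
  least_squares k y = n%:R^-1 *: ((design_matrix R n k)^T *m col_of y).
Proof.
move=> kn; have n0 : (0 < n)%N by exact: leq_ltn_trans kn.
by rewrite /least_squares design_matrix_gram// invmx_scalar mul_scalar_mx -scalemxAl.
Qed.

Lemma least_squares_coord n k (y : Rn R n) (j : 'I_k) : (k < n)%N ->
  least_squares k y j 0 =
  n%:R^-1 * \sum_(i < n) fourier j.+1 (design R i) * tnth y i.
Proof.
move=> kn; rewrite least_squaresE// !mxE; congr (_ * _).
by apply: eq_bigr => i _; rewrite !mxE.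
Qed.

Lemma measurable_least_squares n k (j : 'I_k) : (k < n)%N ->
  measurable_fun setT (fun y : Rn R n => least_squares k y j 0).
Proof.
move=> kn; under eq_fun do rewrite least_squares_coord//.
apply: measurable_funM => //; apply: measurable_sum => i.
by apply: measurable_funM => //; exact: measurable_tnth.
Qed.

Context (alpha : R) (theta : nat -> R) (A : R) (f : R -> R) (n k : nat).
Hypothesis alpha_gt : 1 / 2 < alpha.
Hypothesis ellipsoid : forall N,
  \sum_(1 <= l < N.+1) sobolev_weight alpha l ^+ 2 * theta l ^+ 2 <= A.
Hypothesis fE : forall i : 'I_n,
  (fun N => \sum_(1 <= l < N.+1) theta l * fourier l (design R i)) @ \oo
    --> f (design R i).
Hypothesis n_gt1 : (1 < n)%N.
Hypothesis kn : (k < n)%N.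

Let n_gt0 : (0 < n)%N. Proof. exact: ltnW. Qed.

Definition ls_error (y : Rn R n) : R :=
  \sum_(j < k) (least_squares k y j 0 - theta j.+1) ^+ 2.

Lemma ls_error_ge0 y : 0 <= ls_error y.
Proof. by apply: sumr_ge0 => j _; exact: sqr_ge0. Qed.

Lemma measurable_ls_error : measurable_fun setT ls_error.
Proof.
apply: measurable_sum => j; apply: measurable_funX.
by apply: measurable_funB => //; exact: measurable_least_squares.
Qed.

Definition risk_bound (v : R) : R :=
  2 * (bias_const alpha A * n%:R `^ (- (2 * alpha))) + 2 * (gaussK R * v * (k%:R / n%:R)).

(** The error is bias plus noise. Column orthogonality makes each noise coordinate a linear form
    with squared coefficients summing to 1/n, so the k of them contribute k/n; [bias_le] bounds the
    rest. *)
Lemma ls_risk (v : R) : 0 < v ->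
  (\int[mvnormal (design_values f n) v]_y (ls_error y)%:E <= (risk_bound v)%:E)%E.
Proof.
move=> v0.
pose c (j : 'I_k) (i : 'I_n) : R := n%:R^-1 * fourier j.+1 (design R i).
pose Z j (y : Rn R n) := \sum_i c j i * (tnth y i - design_values f n i 0).
pose b (j : 'I_k) := empirical_coef n f j.+1 - theta j.+1.
have lsE (j : 'I_k) y : least_squares k y j 0 - theta j.+1 = b j + Z j y.
  have -> : Z j y = n%:R^-1 * (\sum_i fourier j.+1 (design R i) * tnth y i) -
      empirical_coef n f j.+1.
    rewrite /Z /c /empirical_coef -mulrBr -sumrB mulr_sumr.
    by apply: eq_bigr => i _; rewrite mxE; ring.
  by rewrite least_squares_coord// /b; ring.
have sumc (j : 'I_k) : \sum_i c j i ^+ 2 = n%:R^-1.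
  rewrite /c; under eq_bigr do rewrite exprMn expr2 [fourier _ _ ^+ 2]expr2.
  rewrite -mulr_sumr sum_fourier_design// design_gram_id ?eqxx ?mulr1//.
  - by rewrite mulfVK// pnatr_eq0 -lt0n.
  - exact: leq_ltn_trans (ltn_ord j) kn.
  - exact: leq_ltn_trans (ltn_ord j) kn.
have mZ j : measurable_fun setT (fun y => (Z j y ^+ 2)%:E).
  by apply/measurable_EFinP; apply: measurable_funX; exact: measurable_linear_form.
have Z0 j y : (0 <= (Z j y ^+ 2)%:E)%E by rewrite lee_fin sqr_ge0.
pose B := \sum_(j < k) b j ^+ 2.
have B0 : 0 <= B by apply: sumr_ge0 => j _; exact: sqr_ge0.
have mSZ : measurable_fun setT (fun y => \sum_(j < k) (Z j y ^+ 2)%:E)%E.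
  exact: emeasurable_sum.
have SZ0 y : (0 <= \sum_(j < k) (Z j y ^+ 2)%:E)%E by exact: sume_ge0.
apply: (@le_trans _ _ (\int[mvnormal (design_values f n) v]_y
    ((2 * B)%:E + 2%:E * \sum_(j < k) (Z j y ^+ 2)%:E))%E).
  apply: ge0_le_integralT => y; first by rewrite lee_fin ls_error_ge0.
  rewrite sumEFin -EFinM -EFinD lee_fin /ls_error /B !mulr_sumr -big_split/=.
  apply: ler_sum => j _; rewrite lsE.
  have := sqr_ge0 (b j - Z j y); nra.
have B20 : (0 <= (2 * B)%:E)%E by rewrite lee_fin mulr_ge0.
have m2SZ : measurable_fun setT (fun y => 2%:E * \sum_(j < k) (Z j y ^+ 2)%:E)%E.
  exact: measurable_funeM.
rewrite ge0_integralD//; last by move=> y _; rewrite mule_ge0.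
rewrite integral_cst// [X in (_ * X)%E]probability_setT mule1.
rewrite ge0_integralZl// ge0_integral_sum//.
rewrite /risk_bound [X in (_ <= X)%E]EFinD; apply: leeD.
  by rewrite lee_fin ler_wpM2l//; exact: bias_le.
rewrite [X in (_ <= X)%E]EFinM lee_wpmul2l//.
apply: (@le_trans _ _ (\sum_(j < k) (gaussK R * v * n%:R^-1)%:E)%E).
  apply: lee_sum => j _; rewrite -(sumc j); exact: mvnormal_sqr_le.
by rewrite sumEFin lee_fin sumr_const card_ord -[leLHS]mulr_natr -!mulrA [n%:R^-1 *
  _]mulrC.
Qed.

End least_squares_risk.

(** * Both expectations at a fixed sample size *)

Section fixed_n.
Context (R : realType) (sigma alpha A : R) (theta : nat -> R) (f : R -> R).
Context (n k : nat) (g : R).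
Hypothesis sigma_gt0 : 0 < sigma.
Hypothesis alpha_gt : 1 / 2 < alpha.
Hypothesis ellipsoid : forall N,
  \sum_(1 <= l < N.+1) sobolev_weight alpha l ^+ 2 * theta l ^+ 2 <= A.
Hypothesis fE : forall x, x \in `[0, 1] ->
  (fun N => \sum_(1 <= l < N.+1) theta l * fourier l x) @ \oo --> f x.
Hypothesis n_gt1 : (1 < n)%N.
Hypothesis k_gt0 : (0 < k)%N.
Hypothesis kn : (k < n)%N.
Hypothesis g_gt0 : 0 < g.
Context d (Omega : measurableType d) (P : probability Omega R)
  (eps : 'I_n -> {RV P >-> measurableTypeR R}).
Hypothesis eps_iid : iid_normal eps sigma.
Context (post : R.-pker (Rn R n) ~> (Rn R k)).
Hypothesis post_posterior : is_posterior (mvnormal 0 g)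
  (fun t => mvnormal (design_matrix R n k *m col_of t) (sigma ^+ 2)) post.

Let n_gt0 : (0 < n)%N. Proof. exact: ltnW. Qed.
Let nR_gt0 : 0 < n%:R :> R. Proof. by rewrite ltr0n. Qed.
Let s2_gt0 : 0 < sigma ^+ 2. Proof. by rewrite exprn_gt0. Qed.
Let v : R := sigma ^+ 2 / n%:R.
Let v_gt0 : 0 < v. Proof. by rewrite divr_gt0. Qed.
Let s : R := shrinkage n (sigma ^+ 2) g.
Let s_lt1 : s < 1.
Proof.
have den : 0 < sigma ^+ 2 + g * n%:R by rewrite addr_gt0// mulr_gt0.
by rewrite /s /shrinkage ltr_pdivrMr// mul1r ltrDr.
Qed.
Hypothesis s_ge : 1 / 2 <= s.

Let K := gaussK R.
Let D : R := (1 - s) / Num.sqrt v.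
Let D0 : 0 <= D. Proof. by rewrite divr_ge0 ?subr_ge0 ?sqrtr_ge0// ltW. Qed.
Let Theta := \sum_(j < k) theta j.+1 ^+ 2.
Let Theta0 : 0 <= Theta. Proof. by apply: sumr_ge0 => j _; exact: sqr_ge0. Qed.
Let K0 : 0 <= K. Proof. exact: gaussK_ge0. Qed.
Let mu := mvnormal (design_values f n) (sigma ^+ 2).
Let err := @ls_error R theta n k.
Let ls (y : Rn R n) := least_squares k y.

Let design01 (i : 'I_n) : design R i \in `[0, 1].
Proof.
rewrite in_itv/= divr_ge0//= ler_pdivrMr// mul1r ler_nat.
exact: ltn_ord.
Qed.

Let risk := risk_bound alpha A n k (sigma ^+ 2).

Let integral_err : (\int[mu]_y (err y)%:E <= risk%:E)%E.
Proof. by apply: ls_risk => // i; exact: fE. Qed.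

(** [F] is not assumed measurable, as total variation is a supremum over all events; it is compared
    with a measurable majorant depending on the observation. *)
Let integral_le (N : set (Rn R n)) (F : Omega -> \bar R) (c1 c2 : R) :
  measurable N -> mu N = 0%E -> 0 <= c1 -> 0 <= c2 -> (forall w, 0 <= F w)%E ->
  (forall w, ~ N (observation f eps w) ->
    F w <= (c1 + c2 * err (observation f eps w))%:E)%E ->
  (\int[P]_w F w <= (c1 + c2 * risk)%:E)%E.
Proof.
move=> mN N0 c10 c20 F0 FN.
(* +oo * 1_N vanishes off N since +oo * 0 = 0, and has integral +oo * mu N = 0. *)
pose h (y : Rn R n) : \bar R := (c1%:E + (c2%:E * (err y)%:E + +oo * (\1_N y)%:E))%E.
have err0 y : (0 <= (err y)%:E)%E by rewrite lee_fin ls_error_ge0.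
have merr : measurable_fun setT (fun y => (err y)%:E).
  by apply/measurable_EFinP; exact: measurable_ls_error.
have mI : measurable_fun setT (fun y => (\1_N y)%:E : \bar R).
  by apply/measurable_EFinP; exact: measurable_indic.
have I0 y : (0 <= (\1_N y)%:E :> \bar R)%E by rewrite lee_fin.
have c1E : (0 <= c1%:E)%E by rewrite lee_fin.
have c2E : (0 <= c2%:E)%E by rewrite lee_fin.
have ooI0 y : (0 <= +oo * (\1_N y)%:E :> \bar R)%E by rewrite mule_ge0.
have cerr0 y : (0 <= c2%:E * (err y)%:E)%E by rewrite mule_ge0.
have mooI : measurable_fun setT (fun y => +oo * (\1_N y)%:E : \bar R)%E.
  exact: measurable_funeM.
have mcerr : measurable_fun setT (fun y => c2%:E * (err y)%:E)%E.
  exact: measurable_funeM.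
have msum : measurable_fun setT (fun y => c2%:E * (err y)%:E + +oo * (\1_N y)%:E)%E.
  exact: emeasurable_funD.
have sum0 y : (0 <= c2%:E * (err y)%:E + +oo * (\1_N y)%:E)%E by rewrite adde_ge0.
have mh : measurable_fun setT h by exact: emeasurable_funD.
have h0 y : (0 <= h y)%E by rewrite adde_ge0.
apply: (@le_trans _ _ (\int[P]_w h (observation f eps w))%E).
  apply: ge0_le_integralT => // w; rewrite /h indicE.
  have [inN|outN] := pselect (N (observation f eps w)).
    rewrite mem_set// (_ : +oo * _ = +oo)%E; last by rewrite mule1.
    exact: leey.
  by rewrite memNset// mule0 adde0 -EFinM -EFinD FN.
rewrite (ge0_integral_observation f sigma_gt0 eps_iid mh h0).
rewrite /h ge0_integralD// integral_cst// [X in (_ * X)%E]probability_setT mule1.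
rewrite ge0_integralD// ge0_integralZl// ge0_integralZl// integral_indic// setIT.
rewrite [X in (+oo * X)%E]N0 mule0 adde0 EFinD leeD2l// EFinM lee_wpmul2l//.
Qed.

Let null_post : exists N : set (Rn R n), [/\ measurable N, mu N = 0%E &
  forall y, ~ N y -> forall B, measurable B ->
    post y B = mvnormal (s *: ls y) (s * v) B].
Proof.
have PhiE := design_matrix_gram R n_gt0 kn.
have [N [mN N0 NP]] := normal_posterior s2_gt0 g_gt0 n_gt0 PhiE post_posterior.
exists N; split; first exact: mN.
  exact: (@mvnormal_null R n 0 (design_values f n) _ _ _ s2_gt0 s2_gt0 mN N0).
move=> y Ny B mB; have := contra_notP (NP y) Ny => /(_ B mB) ->.
by rewrite /ls least_squaresE.
Qed.

(** Inserting |theta_Y|^2 <= 2 [Theta] + 2 [err y] makes the total variation bound affine in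
    [err y]; this is its constant term and [tv_slope] its slope. *)
Definition tv_const : R := (1 + K) * k%:R * (1 - s) + D +
  (2 * K * D + D ^+ 2) * (2 * Theta).

Definition tv_slope : R := (2 * K * D + D ^+ 2) * 2.

Let KD0 : 0 <= 2 * K * D + D ^+ 2.
Proof.
apply: addr_ge0; last exact: sqr_ge0.
by apply: mulr_ge0; [exact: mulr_ge0|exact: D0].
Qed.

Let tv_slope_ge0 : 0 <= tv_slope.
Proof. exact: mulr_ge0 KD0 _. Qed.

Let tv_const_ge0 : 0 <= tv_const.
Proof.
apply: addr_ge0; last by apply: mulr_ge0; [exact: KD0|exact: mulr_ge0].
apply: addr_ge0; last exact: D0.
apply: mulr_ge0; last by rewrite subr_ge0 ltW.
by apply: mulr_ge0 => //; apply: addr_ge0.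
Qed.

Let tv_shrunk y : (tv_dist (mvnormal (s *: ls y) (s * v)) (mvnormal (ls y) v) <=
  (tv_const + tv_slope * err y)%:E)%E.
Proof.
apply: le_trans (tv_dist_shrunk_mvnormal (ls y) v_gt0 s_ge s_lt1) _.
rewrite lee_fin -/D -/K /tv_const /tv_slope.
have h : \sum_i ls y i 0 ^+ 2 <= 2 * Theta + 2 * err y.
  rewrite /Theta /err /ls_error !mulr_sumr -big_split/=; apply: ler_sum => j _.
  rewrite -/(ls y); have := sqr_ge0 (ls y j 0 - 2 * theta j.+1); nra.
move: KD0 h; move: (2 * K * D + D ^+ 2) (\sum_i _) => a b a0 h.
have := ler_wpM2l a0 h; lra.
Qed.

Lemma integral_tv_dist_post :
  (\int[P]_w tv_dist (post (observation f eps w))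
     (mvnormal (least_squares k (observation f eps w)) (sigma ^+ 2 / n%:R)%R) <=
   (tv_const + tv_slope * risk)%:E)%E.
Proof.
have [N [mN N0 NP]] := null_post.
apply: (integral_le mN N0) => //.
  move=> w; apply: (@le_trans _ _ `|post (observation f eps w) set0 -
    mvnormal (least_squares k (observation f eps w)) (sigma ^+ 2 / n%:R)%R set0|%E) => //.
  by apply: ereal_sup_ubound; exists set0.
move=> w Nw; apply: le_trans (tv_shrunk _).
apply: le_ereal_sup => _ [B mB <-]; exists B => //.
by rewrite NP.
Qed.

(** Markov's inequality for the squared norm, bounded by twice the spread around theta_Y, twice the
    least squares error, and the Sobolev tail beyond k. *)
Let post_ball (r : R) y : 0 < r ->
  (mvnormal (ls y) v [set t | r%:E <= L2norm01 (fun x => f_of t x - f x)%R] <=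
   ((r ^+ 2)^-1 * (2 * (K * v * k%:R) + A * k%:R `^ (- (2 * alpha)) + 2 * err y))%:E)%E.
Proof.
move=> r0; set S := [set t | _].
have mS : measurable S.
  by apply: (measurable_L2norm01_ge fE); exact: ltW.
pose Z (t : Rn R k) := \sum_i (tnth t i - ls y i 0) ^+ 2.
pose c := A * k%:R `^ (- (2 * alpha)) + 2 * err y.
have c0 : 0 <= c.
  by rewrite addr_ge0 ?mulr_ge0 ?powR_ge0 ?ls_error_ge0// (ellipsoid_ge0 ellipsoid).
have r2 : 0 < r ^+ 2 by rewrite exprn_gt0.
have Z0 t : (0 <= (Z t)%:E)%E.
  by rewrite lee_fin; apply: sumr_ge0 => i _; exact: sqr_ge0.
have mZ : measurable_fun setT (fun t => (Z t)%:E).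
  by apply/measurable_EFinP; exact: measurable_sum_sqr.
have cE : (0 <= c%:E)%E by rewrite lee_fin.
have m2Z : measurable_fun setT (fun t => 2%:E * (Z t)%:E)%E by exact: measurable_funeM.
have Z20 t : (0 <= 2%:E * (Z t)%:E)%E by rewrite mule_ge0.
have mcZ : measurable_fun setT (fun t => c%:E + 2%:E * (Z t)%:E)%E.
  exact: emeasurable_funD.
have cZ0 t : (0 <= c%:E + 2%:E * (Z t)%:E)%E by rewrite adde_ge0.
rewrite -[S in X in (X <= _)%E]setIT -integral_indic//.
apply: (@le_trans _ _ (\int[mvnormal (ls y) v]_t
    (((r ^+ 2)^-1)%:E * (c%:E + 2%:E * (Z t)%:E)))%E).
  apply: ge0_le_integralT => t; first by rewrite lee_fin.
  rewrite indicE; case: (boolP (t \in S)) => [|_]; last first.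
    by rewrite mule_ge0// lee_fin invr_ge0 ltW.
  rewrite inE /S/= le_L2norm01; last exact: ltW.
  move=> /le_trans /(_ (integral_sqr_sub_le alpha_gt ellipsoid fE k_gt0 t)).
  rewrite lee_fin => h.
  rewrite -[X in (_ <= X)%E]/(((r ^+ 2)^-1 * (c + 2 * Z t))%:E) lee_fin.
  rewrite ler_pdivlMl// mulr1; apply: le_trans h _.
  have : \sum_(j < k) (tnth t j - theta j.+1) ^+ 2 <= 2 * Z t + 2 * err y.
    rewrite /Z /err /ls_error !mulr_sumr -big_split/=; apply: ler_sum => j _.
    rewrite -/(ls y).
    have := sqr_ge0 (tnth t j - ls y j 0 - (ls y j 0 - theta j.+1)); nra.
  by rewrite /c; lra.
rewrite ge0_integralZl//; last by rewrite lee_fin invr_ge0 ltW.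
rewrite EFinM lee_wpmul2l//; first by rewrite lee_fin invr_ge0 ltW.
rewrite ge0_integralD// integral_cst// [X in (_ * X)%E]probability_setT mule1.
rewrite ge0_integralZl//.
have hZ := mvnormal_sum_sqr_le (ls y) v_gt0.
apply: (@le_trans _ _ (c%:E + 2%:E * (K * v * k%:R)%:E)%E).
  by rewrite leeD2l// lee_wpmul2l.
by rewrite -EFinM -EFinD lee_fin /c; lra.
Qed.

(** The posterior mass exceeds the mass under the normal approximation by at most their total
    variation distance; [post_ball] bounds the latter mass. *)
Lemma integral_post_ball (r : R) : 0 < r ->
  (\int[P]_w post (observation f eps w)
     [set t | r%:E <= L2norm01 (fun x => f_of t x - f x)%R] <=
   ((tv_const + (r ^+ 2)^-1 * (2 * (K * v * k%:R) + A * k%:R `^ (- (2 * alpha)))) +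
    (tv_slope + (r ^+ 2)^-1 * 2) * risk)%:E)%E.
Proof.
move=> r0; set S := [set t | _].
have mS : measurable S.
  by apply: (measurable_L2norm01_ge fE); exact: ltW.
have r2 : 0 <= (r ^+ 2)^-1 by rewrite invr_ge0 sqr_ge0.
have [N [mN N0 NP]] := null_post.
apply: (integral_le mN N0).
- apply: addr_ge0 => //; apply: mulr_ge0 => //; apply: addr_ge0.
    by do 3! apply: mulr_ge0 => //; exact: ltW.
  by apply: mulr_ge0; [exact: (ellipsoid_ge0 ellipsoid)|exact: powR_ge0].
- by rewrite addr_ge0// mulr_ge0.
- by [].
move=> w Nw; rewrite NP//; set y := observation f eps w.
have hq : (mvnormal (s *: ls y) (s * v) S <=
    mvnormal (ls y) v S + (tv_const + tv_slope * err y)%:E)%E.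
  have h : (`|mvnormal (s *: ls y) (s * v) S - mvnormal (ls y) v S| <=
      (tv_const + tv_slope * err y)%:E)%E.
    by apply: le_trans (tv_shrunk y); apply: ereal_sup_ubound; exists S.
  rewrite addeC -leeBlDr ?fin_num_measure//.
  exact: le_trans (lee_abs _) h.
apply: le_trans hq _; apply: le_trans (leeD2r _ (post_ball y r0)) _.
by rewrite -EFinD lee_fin; lra.
Qed.

End fixed_n.

(** * Asymptotics *)

Section rates.
Context (R : realType) (alpha c C : R) (n k : nat).
Hypothesis alpha_gt : 1 / 2 < alpha.
Hypothesis c_gt0 : 0 < c.
Hypothesis n_gt0 : (0 < n)%N.
Hypothesis kP : c <= k%:R / n%:R `^ (1 / (1 + 2 * alpha)) <= C.

Let w : R := n%:R `^ (- (alpha / (1 + 2 * alpha))).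
Let kap : R := 1 / (1 + 2 * alpha).
Let den : 0 < 1 + 2 * alpha. Proof. by move: alpha_gt; lra. Qed.
Let n_ge1 : 1 <= n%:R :> R. Proof. by rewrite ler1n. Qed.
Let nR : 0 < n%:R :> R. Proof. by rewrite ltr0n. Qed.
Let pw : 0 < n%:R `^ kap :> R. Proof. exact: powR_gt0. Qed.

Let kC : k%:R <= C * n%:R `^ kap.
Proof. by rewrite -ler_pdivrMr//; case/andP: kP. Qed.

Let ck : c * n%:R `^ kap <= k%:R.
Proof. by rewrite -ler_pdivlMr//; case/andP: kP. Qed.

Let C_gt0 : 0 < C.
Proof. by apply: lt_le_trans c_gt0 _; case/andP: kP; exact: le_trans. Qed.

Lemma rate_k_gt0 : (0 < k)%N.
Proof. by rewrite -(ltr0n R); apply: lt_le_trans ck; rewrite mulr_gt0. Qed.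

Lemma rate_sqr : w ^+ 2 = n%:R `^ (- (2 * alpha / (1 + 2 * alpha))).
Proof. by rewrite sqr_powR; congr (_ `^ _); field; rewrite gt_eqF. Qed.

(** For alpha > 1/2 the exponent 1/(1 + 2 alpha) is below 1/2. *)
Lemma rate_k_sqrt : k%:R <= C * Num.sqrt n%:R.
Proof.
apply: le_trans kC _; rewrite ler_pM2l// -powR12_sqrt ?ler0n//.
rewrite ler_powR// /kap ler_pdivrMr//; move: alpha_gt; lra.
Qed.

(** The choice of k balances the variance k/n against the squared tail k^(-2 alpha): both are of
    order [w ^+ 2]. *)
Lemma rate_k_div_n : k%:R / n%:R <= C * w ^+ 2.
Proof.
rewrite ler_pdivrMr// -mulrA rate_sqr; apply: le_trans kC _.
rewrite ler_pM2l// -[X in _ * X](@powRr1 R n%:R) ?ler0n// -powRD; last first.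
  by rewrite pnatr_eq0 -lt0n n_gt0 implybT.
rewrite ler_powR// le_eqVlt; apply/orP; left; apply/eqP.
by rewrite /kap; field; rewrite gt_eqF.
Qed.

Lemma rate_k_powR : k%:R `^ (- (2 * alpha)) <= c `^ (- (2 * alpha)) * w ^+ 2.
Proof.
have k0 : 0 < k%:R :> R by rewrite ltr0n rate_k_gt0.
have -> : w ^+ 2 = (n%:R `^ kap) `^ (- (2 * alpha)).
  by rewrite rate_sqr -powRrM; congr (_ `^ _); rewrite /kap; field; rewrite gt_eqF.
rewrite -powRM ?(ltW c_gt0) ?(ltW pw)// !powRN.
rewrite lef_pV2 ?posrE ?powR_gt0 ?mulr_gt0//.
rewrite ge0_ler_powR ?nnegrE ?mulr_ge0 ?(ltW c_gt0) ?(ltW pw) ?ler0n//.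
by move: alpha_gt; lra.
Qed.

Lemma rate_n_powR : n%:R `^ (- (2 * alpha)) <= w ^+ 2.
Proof.
rewrite rate_sqr ler_powR// lerN2 ler_pdivrMr//; move: alpha_gt; nra.
Qed.

Lemma rate_sqr_le1 : w ^+ 2 <= 1.
Proof.
rewrite rate_sqr -[leRHS](powRr0 n%:R) ler_powR// oppr_le0 divr_ge0 ?(ltW den)//.
by move: alpha_gt; lra.
Qed.

End rates.

Section shrinkage_rate.
Context (R : realType) (sigma g : R) (n : nat).
Hypothesis sigma_gt0 : 0 < sigma.
Hypothesis g_gt0 : 0 < g.
Hypothesis n_gt0 : (0 < n)%N.

Let s := shrinkage n (sigma ^+ 2) g.
(** The quantity that the assumption on gamma_n sends to 0. *)
Let u : R := 1 / Num.sqrt n%:R / g.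
Let nR : 0 < n%:R :> R. Proof. by rewrite ltr0n. Qed.
Let rn : 0 < Num.sqrt n%:R :> R. Proof. by rewrite sqrtr_gt0. Qed.
Let rnE : n%:R = Num.sqrt n%:R * Num.sqrt n%:R :> R.
Proof. by rewrite -expr2 sqr_sqrtr// ltW. Qed.

Lemma shrinkage_compl_le : 1 - s <= sigma ^+ 2 * u / Num.sqrt n%:R.
Proof.
have s2 : 0 < sigma ^+ 2 by rewrite exprn_gt0.
have gn : 0 < g * n%:R by rewrite mulr_gt0.
have -> : 1 - s = sigma ^+ 2 / (sigma ^+ 2 + g * n%:R).
  by rewrite /s /shrinkage; field; rewrite gt_eqF// addr_gt0.
have -> : sigma ^+ 2 * u / Num.sqrt n%:R = sigma ^+ 2 / (g * n%:R).
  by rewrite [in RHS]rnE /u; field; rewrite !gt_eqF.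
by rewrite ler_pM2l// lef_pV2 ?posrE ?addr_gt0// lerDr ltW.
Qed.

Lemma shrinkage_shift_le : (1 - s) / Num.sqrt (sigma ^+ 2 / n%:R) <= sigma * u.
Proof.
have -> : Num.sqrt (sigma ^+ 2 / n%:R) = sigma / Num.sqrt n%:R.
  by rewrite sqrtrM ?sqr_ge0// sqrtr_sqr gtr0_norm// sqrtrV// ltW.
rewrite ler_pdivrMr ?divr_gt0//; apply: le_trans shrinkage_compl_le _.
by rewrite le_eqVlt; apply/orP; left; apply/eqP; ring.
Qed.

End shrinkage_rate.

Section constants.
Context (R : realType) (sigma alpha A c C : R) (theta : nat -> R).
Hypothesis sigma_gt0 : 0 < sigma.
Hypothesis alpha_gt : 1 / 2 < alpha.
Hypothesis c_gt0 : 0 < c.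
Hypothesis ellipsoid : forall N,
  \sum_(1 <= l < N.+1) sobolev_weight alpha l ^+ 2 * theta l ^+ 2 <= A.

Definition risk_const : R := 2 * bias_const alpha A + 2 * (gaussK R * sigma ^+ 2 * C).

(** A polynomial in [u] without constant term and with coefficients independent of n, so it vanishes
    in the limit. *)
Definition tv_rate (u : R) : R :=
  (1 + gaussK R) * (C * sigma ^+ 2) * u + sigma * u +
  (2 * gaussK R * (sigma * u) + (sigma * u) ^+ 2) *
  (2 * (theta 1 ^+ 2 + A) + 2 * risk_const).

Definition ball_const : R :=
  2 * (gaussK R * (sigma ^+ 2 * C)) + A * c `^ (- (2 * alpha)) + 2 * risk_const.

Context (n k : nat) (g : R).
Hypothesis n_gt1 : (1 < n)%N.
Hypothesis g_gt0 : 0 < g.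
Hypothesis kP : c <= k%:R / n%:R `^ (1 / (1 + 2 * alpha)) <= C.

Let n_gt0 : (0 < n)%N. Proof. exact: ltnW. Qed.
Let w : R := n%:R `^ (- (alpha / (1 + 2 * alpha))).
Let u : R := 1 / Num.sqrt n%:R / g.
Let risk := risk_bound alpha A n k (sigma ^+ 2).
Let K0 := gaussK_ge0 R.
Let bias0 : 0 <= bias_const alpha A := bias_const_ge0 alpha_gt ellipsoid.
Let s2 : 0 < sigma ^+ 2. Proof. by rewrite exprn_gt0. Qed.
Let C_gt0 : 0 < C.
Proof. by apply: lt_le_trans c_gt0 _; case/andP: kP; exact: le_trans. Qed.
Let u_ge0 : 0 <= u.
Proof. by rewrite !divr_ge0 ?sqrtr_ge0// ltW. Qed.

Lemma risk_const_ge0 : 0 <= risk_const.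
Proof.
apply: addr_ge0; apply: mulr_ge0 => //.
by apply: mulr_ge0; [apply: mulr_ge0 => //|]; exact: ltW.
Qed.

Lemma risk_le : risk <= risk_const * w ^+ 2.
Proof.
have h1 := ler_wpM2l bias0 (rate_n_powR alpha_gt n_gt0).
have Ks : 0 <= gaussK R * sigma ^+ 2 by apply: mulr_ge0 => //; exact: ltW.
have h2 := ler_wpM2l Ks (rate_k_div_n alpha_gt c_gt0 n_gt0 kP).
rewrite /risk /risk_bound /risk_const; move: h1 h2; rewrite -/w; lra.
Qed.

(** The Sobolev weight of index 1 is 0, so the ellipsoid does not control theta_1, which is kept
    apart; the tail from index 2 is at most A. *)
Lemma coef_sum_le : \sum_(j < k) theta j.+1 ^+ 2 <= theta 1 ^+ 2 + A.
Proof.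
have := rate_k_gt0 c_gt0 n_gt0 kP; case: k => // k' _.
rewrite big_ord_recl/= lerD2l.
have := sobolev_tail alpha_gt ellipsoid k'.+2 (ltn0Sn 0).
rewrite powR1 mulr1; apply: le_trans.
by rewrite big_add1/= big_add1/= big_mkord.
Qed.

Lemma tv_rate_le :
  tv_const sigma theta n k g + tv_slope sigma n g * risk <= tv_rate u.
Proof.
rewrite /tv_const /tv_slope /tv_rate.
have hD := shrinkage_shift_le sigma_gt0 g_gt0 n_gt0.
have hd := shrinkage_compl_le sigma_gt0 g_gt0 n_gt0.
have hk := rate_k_sqrt alpha_gt c_gt0 n_gt0 kP.
have hr : risk <= risk_const.
  apply: le_trans risk_le _; rewrite ler_piMr ?risk_const_ge0//.
  exact: rate_sqr_le1.
have ht := coef_sum_le.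
have d0 : 0 <= 1 - shrinkage n (sigma ^+ 2) g.
  rewrite subr_ge0 /shrinkage ler_pdivrMr ?addr_gt0 ?mulr_gt0 ?ltr0n//.
  by rewrite mul1r lerDr ltW.
have D0 : 0 <= (1 - shrinkage n (sigma ^+ 2) g) / Num.sqrt (sigma ^+ 2 / n%:R).
  by rewrite divr_ge0 ?sqrtr_ge0.
(* The sqrt n in the bound on k cancels the one in the bound on 1 - s. *)
have hkd : k%:R * (1 - shrinkage n (sigma ^+ 2) g) <= C * sigma ^+ 2 * u.
  apply: (@le_trans _ _ ((C * Num.sqrt n%:R) * (sigma ^+ 2 * u / Num.sqrt n%:R))).
    exact: ler_pM.
  have r0 : Num.sqrt n%:R != 0 :> R by rewrite gt_eqF// sqrtr_gt0 ltr0n.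
  by rewrite le_eqVlt; apply/orP; left; apply/eqP; field.
move: hD hd hkd d0 D0; rewrite -/u.
set dl := 1 - _; set D := dl / _ => hD hd hkd d0 D0.
have S0 : 0 <= \sum_(j < k) theta j.+1 ^+ 2 by apply: sumr_ge0 => j _; exact: sqr_ge0.
have hT : 2 * (\sum_(j < k) theta j.+1 ^+ 2) + 2 * risk <=
    2 * (theta 1 ^+ 2 + A) + 2 * risk_const by lra.
have hD2 : 2 * gaussK R * D + D ^+ 2 <=
    2 * gaussK R * (sigma * u) + (sigma * u) ^+ 2.
  apply: lerD; first by rewrite ler_wpM2l// mulr_ge0.
  by rewrite lerXn2r ?nnegrE// mulr_ge0// ltW.
have D20 : 0 <= 2 * gaussK R * D + D ^+ 2.
  by rewrite addr_ge0 ?sqr_ge0// mulr_ge0// mulr_ge0.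
have T0 : 0 <= 2 * (theta 1 ^+ 2 + A) + 2 * risk_const.
  rewrite addr_ge0 ?mulr_ge0 ?risk_const_ge0 ?addr_ge0 ?sqr_ge0//.
  exact: (ellipsoid_ge0 ellipsoid).
have hprod : (2 * gaussK R * D + D ^+ 2) *
    (2 * (\sum_(j < k) theta j.+1 ^+ 2) + 2 * risk) <=
    (2 * gaussK R * (sigma * u) + (sigma * u) ^+ 2) *
    (2 * (theta 1 ^+ 2 + A) + 2 * risk_const).
  by apply: (@le_trans _ _ ((2 * gaussK R * D + D ^+ 2) *
    (2 * (theta 1 ^+ 2 + A) + 2 * risk_const))); [rewrite ler_wpM2l|rewrite ler_wpM2r].
have hk1 : (1 + gaussK R) * k%:R * dl <= (1 + gaussK R) * (C * sigma ^+ 2) * u.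
  by rewrite -mulrA -[leRHS]mulrA ler_wpM2l// addr_ge0.
move: hprod hk1 hD; lra.
Qed.

(** All error terms are at most a constant times w^2, so division by (lam w)^2 leaves a multiple of
    1 / lam^2. *)
Lemma ball_rate_le (lam : R) : 0 < lam ->
  tv_const sigma theta n k g + ((lam * w) ^+ 2)^-1 *
  (2 * (gaussK R * (sigma ^+ 2 / n%:R) * k%:R) + A * k%:R `^ (- (2 * alpha))) +
  (tv_slope sigma n g + ((lam * w) ^+ 2)^-1 * 2) * risk <=
  tv_rate u + ball_const / lam ^+ 2.
Proof.
move=> lam0.
have w0 : 0 < w by rewrite powR_gt0// ltr0n.
have l2 : 0 < lam ^+ 2 by rewrite exprn_gt0.
have hA := ler_wpM2l (ellipsoid_ge0 ellipsoid) (rate_k_powR alpha_gt c_gt0 n_gt0 kP).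
have hr := risk_le.
have Ks : 0 <= gaussK R * sigma ^+ 2 by apply: mulr_ge0 => //; exact: ltW.
have hk := ler_wpM2l Ks (rate_k_div_n alpha_gt c_gt0 n_gt0 kP).
have h : 2 * (gaussK R * (sigma ^+ 2 / n%:R) * k%:R) + A * k%:R `^ (- (2 * alpha)) +
    2 * risk <= ball_const * w ^+ 2.
  have -> : gaussK R * (sigma ^+ 2 / n%:R) * k%:R = gaussK R * sigma ^+ 2 * (k%:R / n%:R).
    by ring.
  move: hA hr hk; rewrite -/w /ball_const; lra.
have h' : ((lam * w) ^+ 2)^-1 * (2 * (gaussK R * (sigma ^+ 2 / n%:R) * k%:R) +
    A * k%:R `^ (- (2 * alpha)) + 2 * risk) <= ball_const / lam ^+ 2.
  have w2 : 0 < w ^+ 2 by rewrite exprn_gt0.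
  rewrite ler_pdivrMl ?exprn_gt0 ?mulr_gt0//; apply: le_trans h _.
  rewrite exprMn le_eqVlt; apply/orP; left; apply/eqP.
  by field; rewrite gt_eqF.
have := tv_rate_le; move: h'; lra.
Qed.

End constants.

Section limits.
Context (R : realType).

Lemma cvg_tv_rate (sigma alpha A C : R) (theta : nat -> R) (u : nat -> R) :
  u @ \oo --> 0 -> (fun n => tv_rate sigma alpha A C theta (u n)) @ \oo --> 0.
Proof.
move=> u0; have su : sigma * u n @[n --> \oo] --> 0.
  by rewrite -[X in _ --> X](mulr0 sigma); apply: cvgM => //; exact: cvg_cst.
have c1 : (1 + gaussK R) * (C * sigma ^+ 2) * u n @[n --> \oo] --> 0.
  by rewrite -[X in _ --> X](mulr0 ((1 + gaussK R) * (C * sigma ^+ 2)));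
    apply: cvgM => //; exact: cvg_cst.
have c2 : 2 * gaussK R * (sigma * u n) @[n --> \oo] --> 0.
  by rewrite -[X in _ --> X](mulr0 (2 * gaussK R)); apply: cvgM => //; exact: cvg_cst.
have c3 : (sigma * u n) ^+ 2 @[n --> \oo] --> 0.
  by rewrite -[X in _ --> X](mulr0 0); apply: cvgM.
rewrite -[X in _ --> X](_ : 0 + 0 + (0 + 0) *
  (2 * (theta 1 ^+ 2 + A) + 2 * risk_const sigma alpha A C) = 0); last first.
  by rewrite !addr0 mul0r addr0.
rewrite /tv_rate; apply: cvgD; first exact: cvgD.
apply: cvgM; last exact: cvg_cst.
exact: cvgD.
Qed.

Lemma cvg_div_sqr (Q : R) (lam : nat -> R) : lam @ \oo --> +oo ->
  Q / lam n ^+ 2 @[n --> \oo] --> 0.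
Proof.
move=> lamoo; rewrite -[X in _ --> X](mulr0 Q); apply: cvgM; first exact: cvg_cst.
have i0 : (lam n)^-1 @[n --> \oo] --> 0.
  have pos : \forall n \near \oo, 0 < lam n by have /cvgryPgt := lamoo; apply.
  exact: ((gtr0_cvgV0 pos).2 lamoo).
rewrite -[X in _ --> X](mulr0 0); under eq_fun do rewrite -exprVn expr2.
exact: cvgM.
Qed.

Lemma cvg_littleo_ratio (h gamma : nat -> R) :
  (forall n, (0 < n)%N -> 0 < gamma n) -> h =o_\oo gamma ->
  h n / gamma n @[n --> \oo] --> 0.
Proof.
move=> g0 /eqoP ho; apply/cvgrPdist_le => e e0.
near=> n; rewrite sub0r normrN normrM normfV ler_pdivrMr.
  by near: n; exact: ho.
by rewrite normr_gt0 gt_eqF// g0//; near: n; exact: nbhs_infty_gt.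
Unshelve. all: by end_near. Qed.

End limits.

Theorem proposition4 (R : realType)
    (sigma : R) (sigma_gt0 : 0 < sigma)
    (alpha L : R) (alpha_gt : 1 / 2 < alpha) (L_gt0 : 0 < L)
    (f : R -> R) (f_sobolev : sobolev alpha L f)
    (d : nat -> measure_display) (Omega : forall n, measurableType (d n))
    (P : forall n, probability (Omega n) R)
    (eps : forall n, 'I_n -> {RV (P n) >-> measurableTypeR R})
    (eps_iid : forall n, (0 < n)%N -> iid_normal (eps n) sigma)
    (k : nat -> nat)
    (k_asymp : exists c C : R, [/\ 0 < c, 0 < C & forall n, (0 < n)%N ->
       c <= (k n)%:R / n%:R `^ (1 / (1 + 2 * alpha)) <= C])
    (gamma : nat -> R) (gamma_gt0 : forall n, (0 < n)%N -> 0 < gamma n)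
    (gamma_asymp : (fun n : nat => 1 / Num.sqrt n%:R) =o_\oo gamma)
    (post : forall n, R.-pker (Rn R n) ~> (Rn R (k n)))
    (post_posterior : forall n, (0 < n)%N ->
       is_posterior (mvnormal 0 (gamma n))
         (fun theta => mvnormal (design_matrix R n (k n) *m col_of theta)
                                (sigma ^+ 2))
         (post n)) :
  let Y n : Omega n -> Rn R n := observation f (eps n) in
  (fun n => \int[P n]_w
      tv_dist (post n (Y n w))
              (mvnormal (least_squares (k n) (Y n w)) (sigma ^+ 2 / n%:R)%R))%E
    @ \oo --> 0%E
  /\
  forall lambda : nat -> R, lambda @ \oo --> +oo ->
    (fun n => \int[P n]_w
        post n (Y n w)
          [set theta | (lambda n * n%:R `^ (- (alpha / (1 + 2 * alpha))))%R%:E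
                        <= L2norm01 (fun x => f_of theta x - f x)%R])%E
      @ \oo --> 0%E.
Proof.
move=> Y.
have [theta [hsum fE]] := f_sobolev.
pose A : R := L ^+ 2 / pi `^ (2 * alpha).
have ellipsoid N :
    \sum_(1 <= l < N.+1) sobolev_weight alpha l ^+ 2 * theta l ^+ 2 <= A.
  rewrite -lee_fin -sumEFin; apply: le_trans hsum; apply: nneseries_lim_ge => j _ _.
  by rewrite lee_fin mulr_ge0 ?sqr_ge0.
have [c [C [c0 C0 kP]]] := k_asymp.
pose u (n : nat) : R := 1 / Num.sqrt n%:R / gamma n.
have u0 : u n @[n --> \oo] --> 0 by exact: cvg_littleo_ratio.
have T0 := @cvg_tv_rate R sigma alpha A C theta u u0.
have s2 : 0 < sigma ^+ 2 by rewrite exprn_gt0.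
have large : \forall n \near \oo, [/\ (1 < n)%N, (k n < n)%N &
    1 / 2 <= shrinkage n (sigma ^+ 2) (gamma n)].
  near=> n.
  have n1 : (1 < n)%N by near: n; exact: nbhs_infty_gt.
  have n0 : (0 < n)%N by exact: ltnW.
  have nR : 1 <= n%:R :> R by rewrite ler1n.
  have rn1 : 1 <= Num.sqrt n%:R :> R by rewrite -[leLHS]sqrtr1 ler_sqrt// (le_trans _ nR).
  split => //.
    rewrite -(ltr_nat R); apply: le_lt_trans (rate_k_sqrt alpha_gt c0 n0 (kP n n0)) _.
    (* Then C < sqrt n, and k <= C sqrt n < n. *)
    have Cn : C ^+ 2 < n%:R by near: n; exact: nbhs_infty_gtr.
    have CS : C < Num.sqrt n%:R.
      by rewrite -[C]gtr0_norm// -sqrtr_sqr ltr_sqrt// (lt_le_trans _ nR).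
    have := sqr_sqrtr (ler0n R n); move: rn1 CS; move: (Num.sqrt n%:R) => r r1 Cr <-.
    by rewrite expr2 ltr_pM2r// (lt_le_trans _ r1).
  have := shrinkage_compl_le sigma_gt0 (gamma_gt0 n n0) n0.
  rewrite -/(u n) => h.
  (* This threshold makes 1 - s <= sigma^2 u <= 1/2. *)
  have un : u n <= 1 / (2 * sigma ^+ 2).
    near: n; apply: (cvgr_le _ u0); by rewrite divr_gt0// mulr_gt0.
  have u_ge0 : 0 <= u n by rewrite !divr_ge0 ?sqrtr_ge0// ltW// gamma_gt0.
  have h2 : sigma ^+ 2 * u n / Num.sqrt n%:R <= sigma ^+ 2 * u n.
    rewrite ler_pdivrMr ?(lt_le_trans _ rn1)// ler_peMr// mulr_ge0// ltW//.
  have : sigma ^+ 2 * u n <= 1 / 2.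
    apply: (@le_trans _ _ (sigma ^+ 2 * (1 / (2 * sigma ^+ 2)))).
      by rewrite ler_pM2l.
    by rewrite le_eqVlt; apply/orP; left; apply/eqP; field; rewrite gt_eqF.
  by move: h h2; lra.
split.
  apply: (@squeeze_cvge _ _ _ _ (cst 0%E) _
      (fun n => (tv_rate sigma alpha A C theta (u n))%:E)).
  - apply: filterS large => n [n1 kn sn]; have n0 : (0 < n)%N by exact: ltnW.
    apply/andP; split.
      apply: integral_ge0 => w _; apply: ereal_sup_ge; exists `|post n (Y n w) set0 -
        mvnormal (least_squares (k n) (Y n w)) (sigma ^+ 2 / n%:R)%R set0|%E => //.
      by exists set0.
    apply: le_trans (integral_tv_dist_post sigma_gt0 alpha_gt ellipsoid fE n1 kn
      (gamma_gt0 n n0) (eps_iid n n0) (post_posterior n n0) sn) _.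
    rewrite lee_fin; exact: (tv_rate_le sigma_gt0 alpha_gt c0 ellipsoid n1 (gamma_gt0
      n n0) (kP n n0)).
  - exact: cvg_cst.
  - by apply: cvg_EFin; [exact: nearW|exact: T0].
move=> lambda lamoo.
apply: (@squeeze_cvge _ _ _ _ (cst 0%E) _ (fun n =>
  (tv_rate sigma alpha A C theta (u n) + ball_const sigma alpha A c C / lambda n ^+
    2)%:E)).
- near=> n.
  have [n1 kn sn] : [/\ (1 < n)%N, (k n < n)%N &
    1 / 2 <= shrinkage n (sigma ^+ 2) (gamma n)] by near: n.
  have n0 : (0 < n)%N by exact: ltnW.
  have lam0 : 0 < lambda n by near: n; have /cvgryPgt := lamoo; apply.
  apply/andP; split; first by apply: integral_ge0 => w _; exact: measure_ge0.
  have r0 : 0 < lambda n * n%:R `^ (- (alpha / (1 + 2 * alpha))).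
    by rewrite mulr_gt0// powR_gt0// ltr0n.
  have k0 := rate_k_gt0 c0 n0 (kP n n0).
  apply: le_trans (integral_post_ball sigma_gt0 alpha_gt ellipsoid fE n1 k0 kn
      (gamma_gt0 n n0) (eps_iid n n0) (post_posterior n n0) sn r0) _.
  rewrite lee_fin; exact: (ball_rate_le sigma_gt0 alpha_gt c0 ellipsoid n1 (gamma_gt0
    n n0) (kP n n0)).
- exact: cvg_cst.
- apply: cvg_EFin; first exact: nearW.
  rewrite -[X in _ --> X](addr0 0); apply: cvgD; first exact: T0.
  exact: cvg_div_sqr.
Unshelve. all: by end_near. Qed.
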